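(* Let $0<\varphi<\theta<1$ be constants, $B_1,B_2,\dots$ i.i.d. Bernoulli with $\mathbb{P}(B_i=1)=\theta$, $\hat\Theta_n=\frac1n\sum_{i=1}^nB_i$, and abbreviate $P_{\mathrm{X}}=P_{\mathrm{X},n}(\hat\Theta_n|\varphi)$, $P_{\mathrm{CH}}=P_{\mathrm{CH},n}(\hat\Theta_n|\varphi)$, $P_{\mathrm{PBR}}=P_{\mathrm{PBR},n}(\hat\Theta_n|\varphi)$. If $\theta\ne1/2$, then $$-\sqrt n\log\left(\frac{\sqrt{2\pi\theta(1-\theta)}\,P_{\mathrm{PBR}}}{\sqrt n\,P_{\mathrm{CH}}}\right)\xrightarrow{D}N\left(0,\frac{(1-2\theta)^2}{4\theta(1-\theta)}\right).$$ If $\varphi\ne\theta(2\theta-1)$, then $$-\sqrt n\log\left(\frac{\theta-\varphi}{1-\varphi}\sqrt{\frac{2\pi(1-\theta)}{\theta}}\,\frac{\sqrt n\,P_{\mathrm{X}}}{P_{\mathrm{CH}}}\right)\xrightarrow{D}N\left(0,\frac{(\theta(1-2\theta)+\varphi)^2}{4(\theta-\varphi)^2\theta(1-\theta)}\right).$$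
   Context: Logarithms are natural; $\xrightarrow{D}$ denotes convergence in distribution. For an integer $n\ge1$, $0<\varphi<1$ and $t\in[0,1]$ with $nt$ an integer (convention $0^0=1$): $P_{\mathrm{X},n}(t|\varphi)=\sum_{k\ge nt}\binom{n}{k}\varphi^k(1-\varphi)^{n-k}$; $P_{\mathrm{CH},n}(t|\varphi)=\left(\frac{\varphi}{t}\right)^{nt}\left(\frac{1-\varphi}{1-t}\right)^{n(1-t)}$ if $t\ge\varphi$, and $=1$ otherwise; $P_{\mathrm{PBR},n}(t|\varphi)=\varphi^{nt}(1-\varphi)^{n(1-t)}(n+1)\binom{n}{nt}$ if $t\ge\varphi$, and $=t^{nt}(1-t)^{n(1-t)}(n+1)\binom{n}{nt}$ otherwise. *)

(* Defs.v *)
From Stdlib Require Import Reals Lra.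
Open Scope R_scope.

(* Throughout, the random count S_n = sum_{i<=n} B_i ~ Binomial(n, theta),
   and Theta_hat_n = S_n / n.  A value t = k/n of Theta_hat_n is encoded by
   the integer k = n t (0 <= k <= n); all tail/bound functions below take
   (n, k) and use t := INR k / INR n.  Stdlib's [pow] has 0^0 = 1. *)

Definition that (n k : nat) : R := INR k / INR n.

Definition P_X (n k : nat) (phi : R) : R :=
  sum_f_R0 (fun j => if Compare_dec.le_dec k j then C n j * phi ^ j * (1 - phi) ^ (n - j) else 0) n.

Definition P_CH (n k : nat) (phi : R) : R :=
  let t := that n k in
  if Rle_dec phi t then (phi / t) ^ k * ((1 - phi) / (1 - t)) ^ (n - k) else 1.

Definition P_PBR (n k : nat) (phi : R) : R :=
  let t := that n k in
  if Rle_dec phi t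
  then phi ^ k * (1 - phi) ^ (n - k) * INR (n + 1) * C n k
  else t ^ k * (1 - t) ^ (n - k) * INR (n + 1) * C n k.

Definition binom_pmf (n : nat) (theta : R) (k : nat) : R :=
  C n k * theta ^ k * (1 - theta) ^ (n - k).

Definition cdf_of (g : nat -> nat -> R) (theta : R) (n : nat) (x : R) : R :=
  sum_f_R0 (fun k => if Rle_dec (g n k) x then binom_pmf n theta k else 0) n.

Definition is_RInt (f : R -> R) (a b v : R) : Prop :=
  exists pr : Riemann_integrable f a b, RiemannInt pr = v.

Definition normal_density (s2 : R) (t : R) : R :=
  exp (- (t ^ 2) / (2 * s2)) / sqrt (2 * PI * s2).

(* Y_n = g n S_n (n >= 1) converges in distribution to N(0, s2):
   for every x, P(Y_n <= x) -> int_{-oo}^x density, the improper integral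
   being the limit of int_{-m}^x as m -> oo.  (The limit law is continuous,
   so convergence at every x is the standard definition.) *)
Definition conv_dist_normal (g : nat -> nat -> R) (theta s2 : R) : Prop :=
  forall x : R, exists (L : R) (I : nat -> R),
    (forall m : nat, is_RInt (normal_density s2) (- INR m) x (I m)) /\
    Un_cv I L /\
    Un_cv (fun n => cdf_of g theta (S n) x) L.

(* Main.v *)
Require Import Defs.
From Stdlib Require Import Reals Factorial Lra Lia.
From Coquelicot Require Import Rcomplements Rbar Hierarchy Lim_seq Continuity Derive RInt RInt_analysis AutoDerive.
Open Scope R_scope.

(* With z = (S_n - n theta) / sqrt n, Stirling's formula with error O(1/n) turns each
   logarithm into H(S_n / n) + O(1/n) for an explicit H vanishing at theta, uniformly
   for |z| <= M.  For P_X this also uses that the binomial tail at k > n phi equals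
   k (1 - phi) / (k - n phi) times its first term, up to a factor 1 + O(1/n).
   Hence both statistics differ from c z, with c = H'(theta), by a quantity that is
   uniformly small for |z| <= M.  The central limit theorem for z follows from the
   local limit theorem (Stirling again), a Riemann sum over the lattice of values of z,
   and Chebyshev's inequality, which also controls the event |z| > M. *)

(** * Wallis' product and Stirling's formula *)

(** The factor [sqrt n] in front of each logarithm shapes the proof: an error o(1) inside the
    logarithm is too coarse, whereas a relative error O(1/n) leaves only O(1/sqrt n). Hence
    Stirling's formula and the tail estimate come with explicit rates. In each quotient by [P_CH]
    the powers of phi and 1 - phi cancel; with t = S_n / n, what survives is the Stirling prefactor
    sqrt(2 pi n t (1 - t)) and, for [P_X], also t (1 - phi) / (t - phi). The dependence of these
    factors on t is the only source of fluctuation, and the excluded values of theta and phi are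
    those with H'(theta) = 0, where the limit would degenerate. At k = 0 and k = n some logarithms
    have argument 0, so every expansion is confined to |z| <= M; outside, nothing is known about the
    statistics and only the probability of the event counts. *)

Definition wallis (n : nat) : R := RInt (fun x => sin x ^ n) 0 (PI / 2).

Lemma ex_RInt_sin_pow n a b : ex_RInt (fun x => sin x ^ n) a b.
Proof.
apply (ex_RInt_continuous (V := R_CompleteNormedModule)); intros x _.
apply (ex_derive_continuous (V := R_NormedModule)); auto_derive; trivial.
Qed.

Lemma wallis_0 : wallis 0 = PI / 2.
Proof.
unfold wallis; simpl. rewrite RInt_const. unfold scal; simpl; unfold mult; simpl. ring.
Qed.

Lemma wallis_1 : wallis 1 = 1.
Proof.
unfold wallis. apply is_RInt_unique.
replace 1 with (minus (- cos (PI / 2)) (- cos 0)) by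
  (rewrite cos_PI2, cos_0; unfold minus, plus, opp; simpl; ring).
apply (is_RInt_derive (V := R_CompleteNormedModule) (fun x => - cos x)); intros x _.
- auto_derive; trivial. ring.
- apply (ex_derive_continuous (V := R_NormedModule)); auto_derive; trivial.
Qed.

(** Integration by parts, phrased as a primitive: cos x sin^(n+1) x vanishes at both endpoints, and
    its derivative becomes the integrand below once cos^2 is replaced by 1 - sin^2. *)
Lemma wallis_rec n : (INR n + 2) * wallis (S (S n)) = (INR n + 1) * wallis n.
Proof.
assert (H : is_RInt (fun x => (INR n + 1) * sin x ^ n - (INR n + 2) * sin x ^ S (S n))
              0 (PI / 2) (minus (cos (PI / 2) * sin (PI / 2) ^ S n) (cos 0 * sin 0 ^ S n))).
{ apply (is_RInt_derive (V := R_CompleteNormedModule) (fun x => cos x * sin x ^ S n)); intros x _.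
  - auto_derive; trivial.
    replace (match n with O => 1 | S _ => INR n + 1 end) with (INR n + 1)
      by (destruct n; simpl; ring).
    change (Init.Nat.pred (S n)) with n. simpl pow.
    generalize (sin2_cos2 x); unfold Rsqr; intro E.
    apply Rminus_diag_uniq.
    transitivity ((INR n + 1) * sin x ^ n * (sin x * sin x + cos x * cos x - 1)); [ring|].
    rewrite E. ring.
  - apply (ex_derive_continuous (V := R_NormedModule)); auto_derive; trivial. }
assert (H' := RInt_minus (V := R_CompleteNormedModule) (fun x => scal (INR n + 1) (sin x ^ n))
                (fun x => scal (INR n + 2) (sin x ^ S (S n))) 0 (PI / 2)
          (ex_RInt_scal _ _ _ _ (ex_RInt_sin_pow _ _ _))
          (ex_RInt_scal _ _ _ _ (ex_RInt_sin_pow _ _ _))).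
rewrite !(RInt_scal (V := R_CompleteNormedModule)) in H' by apply ex_RInt_sin_pow.
fold (wallis n) in H'; fold (wallis (S (S n))) in H'.
apply (is_RInt_unique (V := R_CompleteNormedModule)) in H.
unfold minus, plus, opp, scal in *; simpl in *; unfold mult in *; simpl in *.
rewrite cos_PI2, sin_0 in H.
assert (E : (INR n + 1) * wallis n + - ((INR n + 2) * wallis (S (S n))) = 0).
{ rewrite <- H'. etransitivity; [|etransitivity; [exact H|]]; [|ring].
  apply RInt_ext; intros x _; reflexivity. }
lra.
Qed.

Lemma wallis_decr n : wallis (S n) <= wallis n.
Proof.
assert (HP := PI2_RGT_0).
unfold wallis; apply RInt_le; try apply ex_RInt_sin_pow; [lra|].
intros x [Hx1 Hx2].
assert (0 <= sin x) by (apply sin_ge_0; lra).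
destruct (SIN_bound x).
assert (0 <= sin x ^ n) by (apply pow_le; trivial). simpl. nra.
Qed.

Lemma wallis_even n :
  wallis (2 * n) * (4 ^ n * INR (fact n) ^ 2) = PI / 2 * INR (fact (2 * n)).
Proof.
induction n as [|n IH].
- simpl. rewrite wallis_0. ring.
- replace (2 * S n)%nat with (S (S (2 * n))) by lia.
  assert (H := wallis_rec (2 * n)).
  assert (H2 := pos_INR n).
  change (fact (S (S (2 * n)))) with ((S (S (2*n))) * ((S (2*n)) * fact (2*n)))%nat.
  change (fact (S n)) with (S n * fact n)%nat.
  rewrite !mult_INR, !S_INR, mult_INR in *; simpl INR in *; replace (0 + 1 + 1) with 2 in * by ring.
  replace (wallis (S (S (2 * n)))) with ((2*INR n + 1) * wallis (2*n) / (2*INR n + 2)).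
  2:{ apply (Rmult_eq_reg_l (2*INR n + 2)); [|lra]. transitivity ((2*INR n + 2 - 1) * wallis (2*n)); [field; lra|lra]. }
  simpl (4 ^ S n).
  transitivity ((2 * INR n + 1) * 2 * (INR n + 1) * (wallis (2 * n) * (4 ^ n * INR (fact n) ^ 2))).
  + field. lra.
  + rewrite IH. field.
Qed.

Lemma wallis_odd n :
  wallis (2 * n + 1) * INR (fact (2 * n + 1)) = 4 ^ n * INR (fact n) ^ 2.
Proof.
induction n as [|n IH].
- simpl. rewrite wallis_1. ring.
- replace (2 * S n + 1)%nat with (S (S (2 * n + 1))) by lia.
  assert (H := wallis_rec (2 * n + 1)).
  assert (H2 := pos_INR n).
  change (fact (S (S (2 * n + 1)))) with ((S (S (2*n+1))) * ((S (2*n+1)) * fact (2*n+1)))%nat.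
  change (fact (S n)) with (S n * fact n)%nat.
  rewrite !mult_INR, !S_INR, plus_INR, mult_INR in *; change (INR 0) with 0 in *; change (INR 1) with 1 in *; change (INR 2) with (1 + 1) in *; replace (0 + 1 + 1) with 2 in * by ring; replace (1 + 1) with 2 in * by ring.
  replace (wallis (S (S (2 * n + 1)))) with ((2*INR n + 1 + 1) * wallis (2*n+1) / (2*INR n + 1 + 2)).
  2:{ apply (Rmult_eq_reg_l (2*INR n + 3)); [|lra]. transitivity ((2*INR n + 3 - 1) * wallis (2*n+1)); [field; lra|lra]. }
  simpl (4 ^ S n).
  transitivity (4 * (INR n + 1) ^ 2 * (wallis (2 * n + 1) * INR (fact (2 * n + 1)))).
  + field. lra.
  + rewrite IH. ring.
Qed.

Lemma wallis_pos n : 0 < wallis (2 * n).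
Proof.
assert (H := wallis_even n).
assert (H1 := INR_fact_lt_0 n). assert (H2 := INR_fact_lt_0 (2 * n)).
assert (0 < 4 ^ n * INR (fact n) ^ 2).
{ apply Rmult_lt_0_compat; [apply pow_lt; lra|apply pow_lt; trivial]. }
assert (0 < PI / 2 * INR (fact (2 * n))) by (apply Rmult_lt_0_compat; [apply PI2_RGT_0|trivial]).
rewrite <- H in H3. nra.
Qed.

(* The logarithm of [W(2n) / W(2n+1)], squeezed between [0] and [1 / (2n+1)]. *)
Lemma wallis_log n :
  0 <= ln (PI / 2) + ln (2 * INR n + 1) + 2 * ln (INR (fact (2 * n))) -
       2 * (INR n * ln 4) - 4 * ln (INR (fact n)) <= / (2 * INR n + 1).
Proof.
assert (He := wallis_even n). assert (Ho := wallis_odd n).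
assert (Hp := wallis_pos n).
assert (H1 := wallis_decr (2 * n)). assert (H2 := wallis_decr (S (2 * n))).
assert (Hr := wallis_rec (2 * n)).
assert (Hn := pos_INR n). assert (HP := PI2_RGT_0).
assert (F1 := INR_fact_lt_0 n). assert (F2 := INR_fact_lt_0 (2 * n)).
replace (2 * n + 1)%nat with (S (2 * n)) in Ho by lia.
change (fact (S (2 * n))) with (S (2 * n) * fact (2 * n))%nat in Ho.
rewrite mult_INR, S_INR, mult_INR in Ho. rewrite mult_INR in Hr. simpl (INR 2) in *.
replace (1 + 1) with 2 in * by ring.
set (x := INR n) in *.
set (r := wallis (2 * n) / wallis (S (2 * n))).
assert (Hq : 0 < wallis (S (2 * n))).
{ eapply Rlt_le_trans; [|exact H2].
  assert (0 < (2 * x + 2) * wallis (S (S (2 * n)))) by (rewrite Hr; nra). nra. }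
assert (F4 : 0 < 4 ^ n) by (apply pow_lt; lra).
assert (Er : r * ((4 ^ n * INR (fact n) ^ 2) ^ 2) = (PI / 2) * (2 * x + 1) * INR (fact (2 * n)) ^ 2).
{ unfold r.
  replace ((4 ^ n * INR (fact n) ^ 2) ^ 2) with
    ((4 ^ n * INR (fact n) ^ 2) * (wallis (S (2 * n)) * ((2 * x + 1) * INR (fact (2 * n))))).
  2:{ rewrite Ho. ring. }
  transitivity (wallis (2 * n) * (4 ^ n * INR (fact n) ^ 2) * ((2 * x + 1) * INR (fact (2 * n)))).
  - field. lra.
  - rewrite He. ring. }
assert (Hr1 : 1 <= r).
{ unfold r. apply (Rmult_le_reg_r (wallis (S (2 * n)))); trivial. field_simplify; lra. }
assert (Hr2 : r <= 1 + / (2 * x + 1)).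
(* Monotonicity gives r <= W(2n) / W(2n+2), and the recursion evaluates this quotient as (2n+2) /
   (2n+1). *)
{ unfold r. apply (Rmult_le_reg_r (wallis (S (2 * n)))); trivial.
  replace (wallis (2 * n) / wallis (S (2 * n)) * wallis (S (2 * n))) with (wallis (2 * n))
    by (field; lra).
  replace (wallis (2 * n)) with ((1 + / (2 * x + 1)) * wallis (S (S (2 * n)))).
  - apply Rmult_le_compat_l; trivial.
    assert (0 < / (2 * x + 1)) by (apply Rinv_0_lt_compat; lra). lra.
  - apply (Rmult_eq_reg_l (2 * x + 1)); [|lra]. rewrite <- Hr. field. lra. }
assert (El : ln (PI / 2) + ln (2 * x + 1) + 2 * ln (INR (fact (2 * n))) -
       2 * (x * ln 4) - 4 * ln (INR (fact n)) = ln r).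
{ apply (f_equal ln) in Er.
  rewrite (ln_mult r), (ln_mult (PI / 2 * _)), (ln_mult (PI / 2)), !ln_pow, ln_mult, !ln_pow in Er;
    try lra; repeat first [exact HP | apply Rmult_lt_0_compat | apply pow_lt]; try lra.
  fold x in Er. simpl (INR 2) in Er. lra. }
rewrite El. split.
- rewrite <- ln_1. apply ln_le; lra.
- assert (ln r <= ln (1 + / (2 * x + 1))) by (apply ln_le; lra).
  assert (0 < / (2 * x + 1)) by (apply Rinv_0_lt_compat; lra).
  assert (ln (1 + / (2 * x + 1)) <= / (2 * x + 1)); [|lra].
  apply Rlt_le. rewrite <- (ln_exp (/ (2 * x + 1))) at 2. apply ln_increasing; [lra|].
  apply exp_ineq1; lra.
Qed.

(** * Bounds for the logarithm and the Stirling remainder *)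

Lemma nonneg_of_derive (f df : R -> R) x :
  0 <= x -> f 0 = 0 -> (forall y, 0 <= y <= x -> is_derive f y (df y)) ->
  (forall y, 0 <= y <= x -> 0 <= df y) -> 0 <= f x.
Proof.
intros [Hx|Hx] H0 Hd Hp; [|rewrite <- Hx, H0; lra].
destruct (MVT_cor2 f df 0 x Hx) as [c [Hc1 Hc2]].
- intros c Hc. apply is_derive_Reals, Hd, Hc.
- assert (0 <= df c) by (apply Hp; lra). nra.
Qed.

(** The rational term is chosen for x = 1/n, where it equals 1 / (n + 1/2) and cancels the factor n
    + 1/2 of the Stirling remainder exactly. The derivative of the gap is x^2 / ((1 + x) (2 + x)^2)
    <= x^2 / 4, which gives the cubic term. *)
Lemma ln1p_bounds x :
  0 <= x -> 2 * x / (2 + x) <= ln (1 + x) <= 2 * x / (2 + x) + x ^ 3 / 12.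
Proof.
intros Hx; split.
- assert (0 <= ln (1 + x) - 2 * x / (2 + x)); [|lra].
  apply (nonneg_of_derive (fun x => ln (1 + x) - 2 * x / (2 + x))
           (fun x => x ^ 2 / ((1 + x) * (2 + x) ^ 2))); trivial.
  + cbv beta. rewrite (Rplus_0_r 1), ln_1. field.
  + intros y Hy. auto_derive; [lra|field; lra].
  + intros y Hy. apply Rdiv_le_0_compat; [nra|].
    apply Rmult_lt_0_compat; [lra|apply pow_lt; lra].
- assert (0 <= 2 * x / (2 + x) + x ^ 3 / 12 - ln (1 + x)); [|lra].
  apply (nonneg_of_derive (fun x => 2 * x / (2 + x) + x ^ 3 / 12 - ln (1 + x))
           (fun x => x ^ 2 / 4 - x ^ 2 / ((1 + x) * (2 + x) ^ 2))); trivial.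
  + cbv beta. rewrite (Rplus_0_r 1), ln_1. field.
  + intros y Hy. auto_derive; [lra|field; lra].
  + intros y Hy.
    assert (y ^ 2 / ((1 + y) * (2 + y) ^ 2) <= y ^ 2 / 4); [|lra].
    apply Rmult_le_compat_l; [nra|]. apply Rinv_le_contravar; nra.
Qed.

Definition stirling_rem (n : nat) : R :=
  ln (INR (fact n)) - ((INR n + 1 / 2) * ln (INR n) - INR n).

(** The decrement equals (n + 1/2) ln(1 + 1/n) - 1. Its upper bound is put in telescoping form, so
    that summing it yields the rate 1 / (4n). *)
Lemma stirling_rem_step n : (1 <= n)%nat ->
  0 <= stirling_rem n - stirling_rem (S n) <= / 4 * (/ INR n - / INR (S n)).
Proof.
intros Hn. assert (Hn' : 1 <= INR n) by (apply (le_INR 1); trivial).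
unfold stirling_rem. change (fact (S n)) with (S n * fact n)%nat.
assert (F := INR_fact_lt_0 n).
rewrite mult_INR, S_INR, ln_mult by lra.
set (x := INR n) in *.
assert (E : ln (x + 1) = ln x + ln (1 + / x)).
{ rewrite <- ln_mult; [f_equal; field; lra|lra|].
  assert (0 < / x) by (apply Rinv_0_lt_compat; lra). lra. }
assert (Hx : 0 < / x) by (apply Rinv_0_lt_compat; lra).
destruct (ln1p_bounds (/ x)) as [L U]; [lra|].
replace (2 * / x / (2 + / x)) with (/ (x + 1 / 2)) in L, U by (field; lra).
assert (L' : 1 <= (x + 1 / 2) * ln (1 + / x)).
{ apply (Rmult_le_compat_l (x + 1 / 2)) in L; [|lra]. rewrite Rinv_r in L; lra. }
assert (U' : (x + 1 / 2) * ln (1 + / x) <= 1 + / 4 * (/ x - / (x + 1))).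
{ apply (Rmult_le_compat_l (x + 1 / 2)) in U; [|lra].
  rewrite Rmult_plus_distr_l, Rinv_r in U by lra.
  (* This amounts to 3 x^2 >= (x + 1/2) (x + 1), an equality at x = 1; this is where the constant
     1/4 comes from. *)
  assert ((x + 1 / 2) * ((/ x) ^ 3 / 12) <= / 4 * (/ x - / (x + 1))); [|lra].
  assert (0 <= / 4 * (/ x - / (x + 1)) - (x + 1 / 2) * ((/ x) ^ 3 / 12)); [|lra].
  replace (/ 4 * (/ x - / (x + 1)) - (x + 1 / 2) * ((/ x) ^ 3 / 12)) with
    ((3 * x ^ 2 - (x + 1 / 2) * (x + 1)) / (12 * x ^ 3 * (x + 1))) by (field; lra).
  apply Rdiv_le_0_compat; [nra|]. repeat apply Rmult_lt_0_compat; lra. }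
rewrite E. lra.
Qed.

Lemma eq0_of_le_inv a K : (forall n, (1 <= n)%nat -> Rabs a <= K / INR n) -> a = 0.
Proof.
intros H. destruct (Req_dec a 0) as [|Ha]; trivial. exfalso.
apply Rabs_pos_lt in Ha.
destruct (nfloor_ex (Rmax 0 (K / Rabs a))) as [n [Hn1 Hn2]]; [apply Rmax_l|].
assert (Hs := pos_INR n).
specialize (H (S n) ltac:(lia)). rewrite S_INR in H.
assert (H0 : K / Rabs a < INR n + 1) by (eapply Rle_lt_trans; [apply Rmax_r|exact Hn2]).
apply Rlt_div_l in H0; trivial. apply Rle_div_r in H; lra.
Qed.

(** The remainder decreases while the remainder minus 1 / (4n) increases, so both enclose the common
    limit l. Wallis' product then identifies l. *)
Lemma stirling n : (1 <= n)%nat ->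
  0 <= stirling_rem n - ln (2 * PI) / 2 <= / (4 * INR n).
Proof.
assert (Hlow : forall n, / 4 * (/ INR 1 - / INR (S n)) >= stirling_rem 1 - stirling_rem (S n)).
{ intros m; induction m as [|m IH]; [lra|].
  assert (H := stirling_rem_step (S m) ltac:(lia)). lra. }
destruct (ex_finite_lim_seq_decr (fun n => stirling_rem (S n)) (stirling_rem 1 - / 4)) as [l Hl].
{ intros m. assert (H := stirling_rem_step (S m) ltac:(lia)). lra. }
{ intros m. specialize (Hlow m). change (INR 1) with 1 in Hlow.
  assert (0 < / INR (S m)) by (apply Rinv_0_lt_compat, lt_0_INR; lia). lra. }
assert (B1 : forall n, (1 <= n)%nat -> l <= stirling_rem n).
{ intros [|k] Hk; [lia|].
  apply (is_lim_seq_decr_compare _ l Hl). intros m.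
  assert (H := stirling_rem_step (S m) ltac:(lia)). lra. }
assert (B2 : forall n, (1 <= n)%nat -> stirling_rem n - / 4 * / INR n <= l).
{ intros [|k] Hk; [lia|].
  apply (is_lim_seq_incr_compare (fun n => stirling_rem (S n) - / 4 * / INR (S n)) l).
  - replace l with (l - / 4 * 0) by ring.
    apply is_lim_seq_minus'; trivial. apply is_lim_seq_mult'; [apply is_lim_seq_const|].
    apply is_lim_seq_incr_1 with (u := fun n => / INR n).
    apply (is_lim_seq_inv INR p_infty); [apply is_lim_seq_INR|discriminate].
  - intros m. assert (H := stirling_rem_step (S m) ltac:(lia)). lra. }
assert (HP := PI_RGT_0).
(* Inserting the enclosures of ln(m!) and ln((2m)!) into [wallis_log] cancels all terms in m ln m, m
   and ln m and leaves ln(2 pi) - 2 l = O(1/m). The constant 5 is a generous bound for the collected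
   errors. *)
assert (E : l - ln (2 * PI) / 2 = 0).
{ apply (eq0_of_le_inv _ 5). intros m Hm.
  assert (Hm' : 1 <= INR m) by (apply (le_INR 1); trivial).
  assert (W := wallis_log m).
  assert (S1 := B1 m Hm). assert (S2 := B2 m Hm).
  assert (T1 := B1 (2 * m)%nat ltac:(lia)). assert (T2 := B2 (2 * m)%nat ltac:(lia)).
  unfold stirling_rem in S1, S2, T1, T2.
  rewrite !mult_INR in T1, T2. change (INR 2) with 2 in T1, T2.
  set (x := INR m) in *.
  rewrite (ln_mult 2 x) in T1, T2 by lra.
  assert (L1 : ln (2 * x + 1) = ln 2 + ln x + ln (1 + / (2 * x))).
  { assert (0 < / (2 * x)) by (apply Rinv_0_lt_compat; lra).
    rewrite <- !ln_mult; try nra. f_equal. field. lra. }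
  assert (L2 : 0 <= ln (1 + / (2 * x)) <= / (2 * x)).
  { assert (0 < / (2 * x)) by (apply Rinv_0_lt_compat; lra). split.
    - rewrite <- ln_1. apply ln_le; lra.
    - rewrite <- (ln_exp (/ (2 * x))) at 2. apply ln_le; [lra|apply exp_ineq1_le]. }
  replace (ln 4) with (2 * ln 2) in W.
  2:{ replace 4 with (2 * 2) by ring. rewrite ln_mult; lra. }
  assert (L3 : ln (PI / 2) = ln (2 * PI) - 2 * ln 2).
  { assert (ln (PI / 2) + 2 * ln 2 = ln (2 * PI)); [|lra].
    replace (2 * PI) with (PI / 2 * (2 * 2)) by field. rewrite !ln_mult; lra. }
  assert (I1 : / (2 * x + 1) <= / x) by (apply Rinv_le_contravar; lra).
  replace (/ (2 * x)) with (/ 2 * / x) in * by (field; lra).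
  assert (0 < / x) by (apply Rinv_0_lt_compat; lra).
  unfold Rdiv at 2. set (y := / x) in *. set (w := / (2 * x + 1)) in *.
  clearbody y w. rewrite L1, L3 in W. clear L1 L3.
  apply Rabs_le. split; nra. }
intros Hn. specialize (B1 n Hn); specialize (B2 n Hn).
rewrite Rinv_mult. lra.
Qed.

(** * Binomial expectations and lattice Riemann sums *)

Definition binom_exp (n : nat) (theta : R) (f : nat -> R) : R :=
  sum_f_R0 (fun k => f k * binom_pmf n theta k) n.

Lemma binom_pmf_S n k theta : (k < n)%nat ->
  binom_pmf (S n) theta (S k) = theta * binom_pmf n theta k + (1 - theta) * binom_pmf n theta (S k).
Proof.
intros Hk. unfold binom_pmf. rewrite <- pascal by trivial.
replace (S n - S k)%nat with (S (n - S k)) by lia.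
replace (n - k)%nat with (S (n - S k)) by lia. simpl. ring.
Qed.

Lemma C_n_0 n : C n 0 = 1.
Proof. unfold C. rewrite Nat.sub_0_r. simpl. field. apply INR_fact_neq_0. Qed.

Lemma C_n_n n : C n n = 1.
Proof. unfold C. rewrite Nat.sub_diag. simpl. field. apply INR_fact_neq_0. Qed.

(** Conditioning on one trial. It yields the total mass and the variance by induction on n. *)
Lemma binom_exp_S n theta f :
  binom_exp (S n) theta f =
  theta * binom_exp n theta (fun k => f (S k)) + (1 - theta) * binom_exp n theta f.
Proof.
(* The end terms are treated apart: Pascal's rule is available only for k < n, and with truncated
   subtraction [C n (S n)] is not 0. *)
assert (H0 : binom_pmf (S n) theta 0 = (1 - theta) * binom_pmf n theta 0).
{ unfold binom_pmf. rewrite !C_n_0, !Nat.sub_0_r. simpl. ring. }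
assert (H1 : binom_pmf (S n) theta (S n) = theta * binom_pmf n theta n).
{ unfold binom_pmf. rewrite !C_n_n, !Nat.sub_diag. simpl. ring. }
assert (H : forall N, (S N <= n)%nat ->
  sum_f_R0 (fun k => f k * binom_pmf (S n) theta k) (S N) =
  theta * sum_f_R0 (fun k => f (S k) * binom_pmf n theta k) N +
  (1 - theta) * sum_f_R0 (fun k => f k * binom_pmf n theta k) (S N)).
{ induction N as [|N IH]; intros HN.
  - simpl. rewrite H0, binom_pmf_S by lia. ring.
  - rewrite tech5, IH, binom_pmf_S by lia.
    rewrite (tech5 (fun k => f (S k) * binom_pmf n theta k)).
    rewrite (tech5 (fun k => f k * binom_pmf n theta k) (S N)). ring. }
unfold binom_exp. rewrite tech5, H1. destruct n as [|n].
- simpl. rewrite H0. ring.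
- rewrite H by lia. rewrite (tech5 (fun k => f (S k) * _)). ring.
Qed.

Lemma binom_exp_ext n theta f g :
  (forall k, f k = g k) -> binom_exp n theta f = binom_exp n theta g.
Proof. intros H. apply sum_eq. intros k _. rewrite H. reflexivity. Qed.

Lemma binom_exp_plus n theta f g :
  binom_exp n theta (fun k => f k + g k) = binom_exp n theta f + binom_exp n theta g.
Proof. unfold binom_exp. rewrite <- plus_sum. apply sum_eq; intros; ring. Qed.

Lemma binom_exp_scal n theta a f :
  binom_exp n theta (fun k => a * f k) = a * binom_exp n theta f.
Proof.
unfold binom_exp. rewrite scal_sum. apply sum_eq; intros; ring.
Qed.

Lemma C_pos n k : 0 < C n k.
Proof.
unfold C. apply Rdiv_lt_0_compat; [|apply Rmult_lt_0_compat]; apply INR_fact_lt_0.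
Qed.

Lemma binom_pmf_pos n theta k : 0 < theta < 1 -> 0 < binom_pmf n theta k.
Proof.
intros H. unfold binom_pmf.
apply Rmult_lt_0_compat; [apply Rmult_lt_0_compat; [apply C_pos|]|]; apply pow_lt; lra.
Qed.

Lemma binom_exp_le n theta f g : 0 < theta < 1 ->
  (forall k, (k <= n)%nat -> f k <= g k) -> binom_exp n theta f <= binom_exp n theta g.
Proof.
intros Ht H. apply sum_Rle. intros k Hk. apply Rmult_le_compat_r; [|auto].
apply Rlt_le, binom_pmf_pos, Ht.
Qed.

Lemma binom_exp_const n theta a : binom_exp n theta (fun _ => a) = a.
Proof.
induction n as [|n IH].
- unfold binom_exp, binom_pmf. simpl. rewrite C_n_0. ring.
- rewrite binom_exp_S, IH. ring.
Qed.

Lemma binom_variance n theta :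
  binom_exp n theta (fun k => (INR k - INR n * theta) ^ 2) = INR n * (theta * (1 - theta)).
Proof.
induction n as [|n IH].
- unfold binom_exp, binom_pmf. simpl. rewrite C_n_0. ring.
- rewrite binom_exp_S.
  rewrite (binom_exp_ext n theta (fun k => (INR (S k) - INR (S n) * theta) ^ 2)
    (fun k => (INR k - INR n * theta) ^ 2 +
              (2 * (1 - theta) * (INR k - INR n * theta) + (1 - theta) ^ 2))).
  2:{ intros k. rewrite !S_INR. ring. }
  rewrite (binom_exp_ext n theta (fun k => (INR k - INR (S n) * theta) ^ 2)
    (fun k => (INR k - INR n * theta) ^ 2 +
              ((- 2 * theta) * (INR k - INR n * theta) + theta ^ 2))).
  2:{ intros k. rewrite !S_INR. ring. }
  rewrite !binom_exp_plus, !binom_exp_scal, !binom_exp_const, IH, S_INR. ring.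
Qed.

(** * Riemann sums over an arithmetic progression *)

Definition ind_Icc (a b x : R) : R :=
  if Rle_dec a x then if Rle_dec x b then 1 else 0 else 0.

Lemma ind_Icc_bounds a b x : 0 <= ind_Icc a b x <= 1.
Proof. unfold ind_Icc. destruct Rle_dec; [destruct Rle_dec|]; lra. Qed.

(* Comparing with increments of F o clip makes the Riemann sum telescope, so that the
   boundary cells need no separate count. *)
Definition clip (a b x : R) : R := Rmax a (Rmin b x).

Lemma clip_cases a b x : a <= b ->
  (x <= a /\ clip a b x = a) \/ (a <= x <= b /\ clip a b x = x) \/ (b <= x /\ clip a b x = b).
Proof.
intros H. unfold clip.
destruct (Rle_lt_dec x a); [left|right; destruct (Rle_lt_dec x b); [left|right]].
- split; trivial. rewrite Rmin_right, Rmax_left; lra.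
- split; [lra|]. rewrite Rmin_right, Rmax_right; lra.
- split; [lra|]. rewrite Rmin_left, Rmax_right; lra.
Qed.

Lemma sum_telescope (G : nat -> R) N :
  sum_f_R0 (fun k => G (S k) - G k) N = G (S N) - G 0%nat.
Proof. induction N as [|N IH]; [reflexivity|]. rewrite tech5, IH. ring. Qed.

Ltac clip_case a b x :=
  let Hab := fresh in
  assert (Hab : a <= b) by lra;
  destruct (clip_cases a b x Hab) as [[? ?]|[[? ?]|[? ?]]]; clear Hab.

Section Lattice.

Variables (f F : R -> R) (D L : R).
Hypothesis f_ge0 : forall x, 0 <= f x.
Hypothesis f_le : forall x, f x <= D.
Hypothesis f_lip : forall x y, Rabs (f x - f y) <= L * Rabs (x - y).
Hypothesis F_der : forall x, is_derive F x (f x).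

Lemma F_mvt x y : x <= y -> exists c, x <= c <= y /\ F y - F x = f c * (y - x).
Proof.
intros [H|H].
- destruct (MVT_cor2 F f x y H) as [c [Hc1 Hc2]].
  + intros c _. apply is_derive_Reals, F_der.
  + exists c. split; [lra|exact Hc1].
- exists x. split; [lra|]. rewrite H. ring.
Qed.

Lemma F_incr x y : x <= y -> F x <= F y.
Proof.
intros H. destruct (F_mvt x y H) as [c [_ Hc]]. assert (Hp := f_ge0 c). nra.
Qed.

Lemma F_lip x y : x <= y -> F y - F x <= D * (y - x).
Proof.
intros H. destruct (F_mvt x y H) as [c [_ Hc]]. assert (Hp := f_le c). rewrite Hc. nra.
Qed.

Lemma lip_ge0 : 0 <= L.
Proof.
assert (H := f_lip 1 0). assert (Ha := Rabs_pos (f 1 - f 0)).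
rewrite (Rabs_right (1 - 0)) in H; lra.
Qed.

Lemma F_step x h : 0 <= h -> Rabs (F (x + h) - F x - h * f x) <= L * h * h.
Proof.
intros H. destruct (F_mvt x (x + h)) as [c [Hc1 Hc2]]; [lra|].
rewrite Hc2. replace (f c * (x + h - x) - h * f x) with (h * (f c - f x)) by ring.
rewrite Rabs_mult, Rabs_right by lra.
assert (Hl := f_lip c x). rewrite (Rabs_right (c - x)) in Hl by lra.
assert (HL := lip_ge0).
assert (L * (c - x) <= L * h) by (apply Rmult_le_compat_l; lra).
assert (h * Rabs (f c - f x) <= h * (L * h)) by (apply Rmult_le_compat_l; lra). lra.
Qed.

Variables (x0 h a b : R) (N : nat).
Hypothesis h_pos : 0 < h.

Let x (k : nat) : R := x0 + INR k * h.

Lemma xS k : x (S k) = x k + h.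
Proof. unfold x. rewrite S_INR. ring. Qed.

(** Each lattice point of [a, b] owns the cell of length h to its right, which lies in [a, b + h].
    The count times h is thus bounded, and local errors of order h^2 add up to O(h). *)
Lemma lattice_count : a <= b ->
  h * sum_f_R0 (fun k => ind_Icc a b (x k)) N <= b - a + h.
Proof.
intros Hab.
apply Rle_trans with (clip a (b + h) (x (S N)) - clip a (b + h) (x 0%nat)).
- rewrite <- sum_telescope with (G := fun k => clip a (b + h) (x k)), scal_sum.
  apply sum_Rle. intros k _. rewrite xS. unfold ind_Icc.
  clip_case a (b + h) (x k); clip_case a (b + h) (x k + h);
  destruct Rle_dec; try destruct Rle_dec; try lra.
- clip_case a (b + h) (x 0%nat); clip_case a (b + h) (x (S N)); lra.
Qed.

(** A cell that starts in [a, b] stays in [a, b + h], where clipping leaves it unchanged; every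
    other cell has a nonnegative increment of the clipped F. *)
Lemma lattice_upper : a <= b ->
  sum_f_R0 (fun k => ind_Icc a b (x k) * (h * f (x k))) N <=
  F (b + h) - F a + L * h * (b - a + h).
Proof.
intros Hab.
apply Rle_trans with (F (clip a (b + h) (x (S N))) - F (clip a (b + h) (x 0%nat)) +
  L * h * (h * sum_f_R0 (fun k => ind_Icc a b (x k)) N)).
- rewrite <- sum_telescope with (G := fun k => F (clip a (b + h) (x k))).
  rewrite <- Rmult_assoc, (scal_sum _ _ (L * h * h)), <- plus_sum.
  apply sum_Rle. intros k _. rewrite xS.
  assert (Hs := F_step (x k) h ltac:(lra)). apply Rabs_le_between in Hs.
  assert (Hm : F (clip a (b + h) (x k)) <= F (clip a (b + h) (x k + h))).
  { apply F_incr. clip_case a (b + h) (x k); clip_case a (b + h) (x k + h); lra. }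
  unfold ind_Icc in *. destruct Rle_dec; [destruct Rle_dec|]; try lra.
  assert (E1 : clip a (b + h) (x k) = x k) by (clip_case a (b + h) (x k); lra).
  assert (E2 : clip a (b + h) (x k + h) = x k + h) by (clip_case a (b + h) (x k + h); lra).
  rewrite E1, E2. lra.
- assert (HL := lip_ge0). assert (Hc := lattice_count Hab).
  apply (Rmult_le_compat_l (L * h)) in Hc; [|apply Rmult_le_pos; lra].
  assert (F (clip a (b + h) (x (S N))) <= F (b + h)).
  { apply F_incr. clip_case a (b + h) (x (S N)); lra. }
  assert (F a <= F (clip a (b + h) (x 0%nat))).
  { apply F_incr. clip_case a (b + h) (x 0%nat); lra. }
  lra.
Qed.

(** Clipping to [a + h, b] removes every cell that starts outside [a, b]: one starting before a ends
    before a + h. The two range hypotheses say that the lattice covers [a + h, b], so the telescoped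
    sum is the full increment of F. *)
Lemma lattice_lower : a + h <= b -> x 0%nat <= a + h -> b <= x (S N) ->
  F b - F (a + h) - L * h * (b - a + h) <=
  sum_f_R0 (fun k => ind_Icc a b (x k) * (h * f (x k))) N.
Proof.
intros Hab Hx0 HxN.
apply Rle_trans with (F (clip (a + h) b (x (S N))) - F (clip (a + h) b (x 0%nat)) +
  (- (L * h)) * (h * sum_f_R0 (fun k => ind_Icc a b (x k)) N)).
- assert (HL := lip_ge0). assert (Hc := lattice_count ltac:(lra)).
  apply (Rmult_le_compat_l (L * h)) in Hc; [|apply Rmult_le_pos; lra].
  assert (E1 : clip (a + h) b (x (S N)) = b) by (clip_case (a + h) b (x (S N)); lra).
  assert (E2 : clip (a + h) b (x 0%nat) = a + h) by (clip_case (a + h) b (x 0%nat); lra).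
  rewrite E1, E2. lra.
- rewrite <- sum_telescope with (G := fun k => F (clip (a + h) b (x k))).
  rewrite <- Rmult_assoc, (scal_sum _ _ (- (L * h) * h)), <- plus_sum.
  apply sum_Rle. intros k _. rewrite xS.
  assert (Hs := F_step (x k) h ltac:(lra)). apply Rabs_le_between in Hs.
  unfold ind_Icc in *. destruct Rle_dec; [destruct Rle_dec|].
  + assert (F (clip (a + h) b (x k + h)) <= F (x k + h)).
    { apply F_incr. clip_case (a + h) b (x k + h); lra. }
    assert (F (x k) <= F (clip (a + h) b (x k))).
    { apply F_incr. clip_case (a + h) b (x k); lra. }
    lra.
  + assert (E1 : clip (a + h) b (x k) = b) by (clip_case (a + h) b (x k); lra).
    assert (E2 : clip (a + h) b (x k + h) = b) by (clip_case (a + h) b (x k + h); lra).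
    rewrite E1, E2. lra.
  + assert (E1 : clip (a + h) b (x k) = a + h) by (clip_case (a + h) b (x k); lra).
    assert (E2 : clip (a + h) b (x k + h) = a + h) by (clip_case (a + h) b (x k + h); lra).
    rewrite E1, E2. lra.
Qed.

Lemma lattice_riemann : a + h <= b -> x 0%nat <= a + h -> b <= x (S N) ->
  Rabs (sum_f_R0 (fun k => ind_Icc a b (x k) * (h * f (x k))) N - (F b - F a)) <=
  h * (D + L * (b - a + h)).
Proof.
intros Hab Hx0 HxN.
assert (H1 := lattice_upper ltac:(lra)). assert (H2 := lattice_lower Hab Hx0 HxN).
assert (H3 := F_lip a (a + h) ltac:(lra)). assert (H4 := F_lip b (b + h) ltac:(lra)).
apply Rabs_le. split; nra.
Qed.

End Lattice.

(** * The normal density and central windows *)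

Lemma exp_le x y : x <= y -> exp x <= exp y.
Proof. intros [H| ->]; [apply Rlt_le, exp_increasing, H|apply Rle_refl]. Qed.

Lemma normal_density_pos v t : 0 < v -> 0 < normal_density v t.
Proof.
intros Hv. assert (HP := PI_RGT_0). apply Rdiv_lt_0_compat; [apply exp_pos|].
apply sqrt_lt_R0. apply Rmult_lt_0_compat; lra.
Qed.

Lemma normal_density_derive v t : 0 < v ->
  is_derive (normal_density v) t (- (t / v) * normal_density v t).
Proof.
intros Hv. unfold normal_density. assert (HP := PI_RGT_0).
assert (0 < sqrt (2 * PI * v)) by (apply sqrt_lt_R0; apply Rmult_lt_0_compat; lra).
auto_derive; trivial. change (- (t * (t * 1)) * / (2 * v)) with (- t ^ 2 / (2 * v)). field. lra.
Qed.

Lemma normal_density_le v t : 0 < v -> normal_density v t <= / sqrt (2 * PI * v).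
Proof.
intros Hv. unfold normal_density. assert (HP := PI_RGT_0).
assert (0 < sqrt (2 * PI * v)) by (apply sqrt_lt_R0; apply Rmult_lt_0_compat; lra).
rewrite <- (Rmult_1_l (/ _)). apply Rmult_le_compat_r.
- apply Rlt_le, Rinv_0_lt_compat; trivial.
- rewrite <- exp_0. apply exp_le. unfold Rdiv.
  assert (0 < / (2 * v)) by (apply Rinv_0_lt_compat; lra). nra.
Qed.

Definition normal_lip (v : R) : R := (1 + 2 * v) / v / sqrt (2 * PI * v).

Lemma normal_density_derive_le v t : 0 < v ->
  Rabs (- (t / v) * normal_density v t) <= normal_lip v.
Proof.
intros Hv. unfold normal_density, normal_lip. assert (HP := PI_RGT_0).
assert (Hs : 0 < sqrt (2 * PI * v)) by (apply sqrt_lt_R0; apply Rmult_lt_0_compat; lra).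
set (u := t ^ 2 / (2 * v)).
assert (Hu : 0 <= u) by (apply Rdiv_le_0_compat; [apply pow2_ge_0|lra]).
replace (- t ^ 2 / (2 * v)) with (- u) by (unfold u; field; lra).
replace (- (t / v) * (exp (- u) / sqrt (2 * PI * v))) with
  (- (t * exp (- u)) / v / sqrt (2 * PI * v)) by (field; lra).
unfold Rdiv. rewrite !Rabs_mult, !Rabs_inv, Rabs_Ropp, Rabs_mult.
rewrite (Rabs_right v), (Rabs_right (sqrt _)), (Rabs_right (exp _)); try lra.
2:{ apply Rle_ge, Rlt_le, exp_pos. }
repeat apply Rmult_le_compat_r; try (apply Rlt_le, Rinv_0_lt_compat; lra).
rewrite exp_Ropp. assert (He := exp_ineq1_le u).
apply (Rmult_le_reg_r (exp u)); [apply exp_pos|].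
rewrite Rmult_assoc, Rinv_l, Rmult_1_r by (apply Rgt_not_eq, exp_pos).
(* The constant of [normal_lip] comes from |t| <= 1 + t^2 = 1 + 2 v u <= (1 + 2 v) (1 + u) together
   with 1 + u <= exp u. *)
apply Rle_trans with ((1 + 2 * v) * (1 + u)); [|apply Rmult_le_compat_l; lra].
assert (Et : t ^ 2 = 2 * v * u) by (unfold u; field; lra).
assert (Ha : Rabs t ^ 2 = t ^ 2) by (rewrite RPow_abs, Rabs_right; trivial; apply Rle_ge, pow2_ge_0).
assert (0 <= Rabs t) by apply Rabs_pos.
nra.
Qed.

Lemma normal_density_lip v x y : 0 < v ->
  Rabs (normal_density v x - normal_density v y) <= normal_lip v * Rabs (x - y).
Proof.
intros Hv.
destruct (MVT_gen (normal_density v) y x (fun t => - (t / v) * normal_density v t)) as [c [_ Hc]].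
- intros; apply normal_density_derive; trivial.
- intros t _. apply derivable_continuous_pt. exists (- (t / v) * normal_density v t).
  apply is_derive_Reals, normal_density_derive; trivial.
- rewrite Hc, Rabs_mult. apply Rmult_le_compat_r; [apply Rabs_pos|].
  apply normal_density_derive_le; trivial.
Qed.

Lemma normal_density_continuous v x : 0 < v -> continuous (normal_density v) x.
Proof.
intros Hv. apply (ex_derive_continuous (V := R_NormedModule)).
eexists. apply normal_density_derive; trivial.
Qed.

Lemma ex_RInt_normal v a b : 0 < v -> ex_RInt (normal_density v) a b.
Proof.
intros Hv. apply (ex_RInt_continuous (V := R_CompleteNormedModule)).
intros. apply normal_density_continuous; trivial.
Qed.

Lemma RInt_normal_derive v x : 0 < v ->
  is_derive (fun y => RInt (normal_density v) 0 y) x (normal_density v x).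
Proof.
intros Hv. apply (is_derive_RInt (V := R_NormedModule) (normal_density v) _ 0).
- exists (mkposreal 1 Rlt_0_1). intros y _. apply (RInt_correct (V := R_CompleteNormedModule)), ex_RInt_normal; trivial.
- apply normal_density_continuous; trivial.
Qed.

Lemma RInt_normal_sub v a b : 0 < v ->
  RInt (normal_density v) 0 b - RInt (normal_density v) 0 a = RInt (normal_density v) a b.
Proof.
intros Hv. rewrite <- (RInt_Chasles (normal_density v) 0 a b); try (apply ex_RInt_normal; trivial).
unfold plus; simpl. ring.
Qed.

(** * Centred counts and uniform smallness on windows *)

Definition zscore (theta : R) (n k : nat) : R := (INR k - INR n * theta) / sqrt (INR n).

Lemma eventually_sqrt_INR_ge K : exists N, forall n, (N <= n)%nat -> 1 <= INR n /\ K <= sqrt (INR n).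
Proof.
destruct (nfloor_ex (Rmax 0 (K * K))) as [m [_ Hm]]; [apply Rmax_l|].
exists (S m). intros n Hn. apply le_INR in Hn. rewrite S_INR in Hn.
assert (Hm' := pos_INR m). split; [lra|].
destruct (Rle_lt_dec K 0); [assert (H := sqrt_pos (INR n)); lra|].
rewrite <- (sqrt_square K) by lra. apply sqrt_le_1_alt.
assert (H := Rmax_r 0 (K * K)). lra.
Qed.

Lemma lattice_normal theta v a b : 0 < theta < 1 -> 0 < v -> a < b ->
  Un_cv (fun n => sum_f_R0 (fun k => ind_Icc a b (zscore theta n k) *
             (/ sqrt (INR n) * normal_density v (zscore theta n k))) n)
        (RInt (normal_density v) a b).
Proof.
intros Ht Hv Hab eps Heps.
set (D := / sqrt (2 * PI * v)). set (L := normal_lip v).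
(* The values of z form a lattice from - s theta with step 1/s, where s = [sqrt n]. The four
   thresholds ensure in turn that a step fits into [a, b], that the lattice starts to the left of a,
   that it reaches beyond b, and that the Riemann error is below eps. *)
destruct (eventually_sqrt_INR_ge (/ (b - a))) as [N1 H1].
destruct (eventually_sqrt_INR_ge (- a / theta)) as [N2 H2].
destruct (eventually_sqrt_INR_ge (b / (1 - theta))) as [N3 H3].
destruct (eventually_sqrt_INR_ge (2 * (Rabs (D + L * (b - a + 1)) / eps) + 1)) as [N4 H4].
exists (N1 + N2 + N3 + N4)%nat. intros n Hn.
destruct (H1 n ltac:(lia)) as [Hn1 K1]. destruct (H2 n ltac:(lia)) as [_ K2].
destruct (H3 n ltac:(lia)) as [_ K3]. destruct (H4 n ltac:(lia)) as [_ K4].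
set (s := sqrt (INR n)) in *.
assert (Es : s * s = INR n) by (apply sqrt_sqrt; lra).
assert (Hs : 1 <= s) by (rewrite <- sqrt_1; apply sqrt_le_1_alt; trivial).
assert (Hi : 0 < / s <= 1).
{ split; [apply Rinv_0_lt_compat; lra|]. rewrite <- Rinv_1. apply Rinv_le_contravar; lra. }
assert (Ez : forall k, zscore theta n k = - (s * theta) + INR k * / s).
{ intros k. unfold zscore. fold s. rewrite <- Es. field. lra. }
unfold Rdist. rewrite <- RInt_normal_sub by trivial.
assert (HL := lip_ge0 (normal_density v) L (fun x y => normal_density_lip v x y Hv)).
assert (B1 : a + / s <= b).
{ assert (/ s <= b - a); [|lra]. rewrite <- (Rinv_inv (b - a)).
  apply Rinv_le_contravar; [apply Rinv_0_lt_compat; lra|trivial]. }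
assert (B2 : - (s * theta) + INR 0 * / s <= a + / s).
{ apply Rle_div_l in K2; [|lra]. simpl. lra. }
assert (B3 : b <= - (s * theta) + INR (S n) * / s).
{ apply Rle_div_l in K3; [|lra]. rewrite S_INR, <- Es.
  replace ((s * s + 1) * / s) with (s + / s) by (field; lra). lra. }
assert (H := lattice_riemann (normal_density v) (fun y => RInt (normal_density v) 0 y) D L
  (fun x => Rlt_le _ _ (normal_density_pos v x Hv)) (fun x => normal_density_le v x Hv)
  (fun x y => normal_density_lip v x y Hv) (fun x => RInt_normal_derive v x Hv)
  (- (s * theta)) (/ s) a b n (proj1 Hi) B1 B2 B3).
rewrite (sum_eq _ (fun k => ind_Icc a b (- (s * theta) + INR k * / s) *
             (/ s * normal_density v (- (s * theta) + INR k * / s)))) by (intros; rewrite Ez; trivial).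
eapply Rle_lt_trans; [exact H|].
apply Rle_lt_trans with (/ s * Rabs (D + L * (b - a + 1))).
- apply Rmult_le_compat_l; [lra|]. eapply Rle_trans; [|apply Rle_abs].
  apply Rplus_le_compat_l, Rmult_le_compat_l; lra.
- apply (Rmult_lt_reg_l s); [lra|]. rewrite <- Rmult_assoc, Rinv_r, Rmult_1_l by lra.
  assert (0 <= Rabs (D + L * (b - a + 1)) / eps)
    by (apply Rdiv_le_0_compat; [apply Rabs_pos|lra]).
  apply Rlt_div_l; lra.
Qed.

(* Negligible uniformly over the central windows [|S_n - n theta| <= M sqrt n]:
   the deterministic substitute for "tends to 0 in probability". *)
Definition window_null (theta : R) (e : nat -> nat -> R) : Prop :=
  forall M eps, 0 < eps -> exists N, forall n k, (N <= n)%nat -> (k <= n)%nat ->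
    Rabs (zscore theta n k) <= M -> Rabs (e n k) <= eps.

Lemma window_null_plus theta e1 e2 : window_null theta e1 -> window_null theta e2 ->
  window_null theta (fun n k => e1 n k + e2 n k).
Proof.
intros H1 H2 M eps Heps.
destruct (H1 M (eps / 2) ltac:(lra)) as [N1 K1].
destruct (H2 M (eps / 2) ltac:(lra)) as [N2 K2].
exists (N1 + N2)%nat. intros n k Hn Hk Hz.
specialize (K1 n k ltac:(lia) Hk Hz). specialize (K2 n k ltac:(lia) Hk Hz).
eapply Rle_trans; [apply Rabs_triang|lra].
Qed.

Lemma window_null_scal theta c e : window_null theta e -> window_null theta (fun n k => c * e n k).
Proof.
intros H M eps Heps. assert (Hc := Rabs_pos c).
destruct (H M (eps / (Rabs c + 1))) as [N K]; [apply Rdiv_lt_0_compat; lra|].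
exists N. intros n k Hn Hk Hz. specialize (K n k Hn Hk Hz).
rewrite Rabs_mult. apply Rle_div_r in K; [|lra].
assert (H0 := Rabs_pos (e n k)). nra.
Qed.

Lemma window_null_le theta e e' :
  (forall M, exists N, forall n k, (N <= n)%nat -> (k <= n)%nat ->
     Rabs (zscore theta n k) <= M -> Rabs (e' n k) <= Rabs (e n k)) ->
  window_null theta e -> window_null theta e'.
Proof.
intros H He M eps Heps. destruct (He M eps Heps) as [N1 K1]. destruct (H M) as [N2 K2].
exists (N1 + N2)%nat. intros n k Hn Hk Hz.
eapply Rle_trans; [apply K2|apply K1]; trivial; lia.
Qed.

Lemma window_that theta M delta : 0 < delta ->
  exists N, forall n k, (N <= n)%nat -> (k <= n)%nat -> Rabs (zscore theta n k) <= M ->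
    1 <= INR n /\ Rabs (that n k - theta) < delta /\
    zscore theta n k = sqrt (INR n) * (that n k - theta).
Proof.
intros Hd. destruct (eventually_sqrt_INR_ge (M / delta + 1)) as [N H].
exists N. intros n k Hn Hk Hz. destruct (H n Hn) as [H1 H2].
set (s := sqrt (INR n)) in *.
assert (Es : s * s = INR n) by (apply sqrt_sqrt; lra).
assert (Hs : 1 <= s) by (rewrite <- sqrt_1; apply sqrt_le_1_alt; trivial).
assert (E : zscore theta n k = s * (that n k - theta)).
{ unfold zscore, that. fold s. rewrite <- Es. field. lra. }
split; [trivial|]. split; [|trivial].
rewrite E, Rabs_mult, (Rabs_right s) in Hz by lra.
assert (M / delta < s) by lra. apply Rlt_div_l in H0; trivial.
apply (Rmult_lt_reg_l s); lra.
Qed.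

Lemma window_null_inv_sqrt theta K : window_null theta (fun n _ => K / sqrt (INR n)).
Proof.
intros M eps Heps. destruct (eventually_sqrt_INR_ge (Rabs K / eps)) as [N H].
exists N. intros n k Hn _ _. destruct (H n Hn) as [H1 H2].
assert (0 < sqrt (INR n)) by (apply sqrt_lt_R0; lra).
unfold Rdiv. rewrite Rabs_mult, Rabs_inv, (Rabs_right (sqrt _)) by lra.
apply Rle_div_l in H2; trivial. apply Rle_div_l; lra.
Qed.

Lemma is_derive_remainder (H : R -> R) theta c eps : is_derive H theta c -> 0 < eps ->
  exists delta, 0 < delta /\ forall t, Rabs (t - theta) < delta ->
    Rabs (H t - H theta - c * (t - theta)) <= eps * Rabs (t - theta).
Proof.
intros Hd Heps. apply is_derive_Reals in Hd.
destruct (Hd eps Heps) as [[d Hd0] Hd']. exists d. split; trivial. intros t Ht.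
destruct (Req_dec t theta) as [->|Hne].
- rewrite !Rminus_diag, Rmult_0_r, Rminus_diag, Rabs_R0. lra.
- specialize (Hd' (t - theta) ltac:(lra) Ht). replace (theta + (t - theta)) with t in Hd' by ring.
  replace (H t - H theta - c * (t - theta)) with
    (((H t - H theta) / (t - theta) - c) * (t - theta)) by (field; lra).
  rewrite Rabs_mult. apply Rmult_le_compat_r; [apply Rabs_pos|lra].
Qed.

(** The delta method: z = sqrt n (t - theta), so sqrt n times a remainder o(|t - theta|) is o(|z|),
    uniformly for |z| <= M. *)
Lemma window_null_derive theta (H : R -> R) c : is_derive H theta c -> H theta = 0 ->
  window_null theta (fun n k => sqrt (INR n) * H (that n k) - c * zscore theta n k).
Proof.
intros Hd H0 M eps Heps.
destruct (is_derive_remainder H theta c (eps / (Rabs M + 1)) Hd) as [delta [Hdel Hr]].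
{ apply Rdiv_lt_0_compat; trivial. assert (Hc := Rabs_pos M). lra. }
destruct (window_that theta M delta Hdel) as [N HN]. exists N. intros n k Hn Hk Hz.
destruct (HN n k Hn Hk Hz) as [H1 [H2 H3]].
specialize (Hr _ H2). rewrite H0, Rminus_0_r in Hr. rewrite H3 in *.
set (s := sqrt (INR n)) in *. assert (Hs := sqrt_pos (INR n)). fold s in Hs.
replace (s * H (that n k) - c * (s * (that n k - theta))) with
  (s * (H (that n k) - c * (that n k - theta))) by ring.
rewrite Rabs_mult, (Rabs_right s) in * by lra.
apply Rle_trans with (eps / (Rabs M + 1) * (s * Rabs (that n k - theta))).
- rewrite <- Rmult_assoc, (Rmult_comm _ s), Rmult_assoc. apply Rmult_le_compat_l; trivial.
- assert (Hc := Rle_abs M). assert (Hc' := Rabs_pos M).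
  apply Rle_trans with (eps / (Rabs M + 1) * (Rabs M + 1)); [|right; field; lra].
  apply Rmult_le_compat_l; [apply Rlt_le, Rdiv_lt_0_compat|]; lra.
Qed.

Lemma window_null_continuous theta (H : R -> R) c : is_derive H theta c -> H theta = 0 ->
  window_null theta (fun n k => H (that n k)).
Proof.
intros Hd H0 M eps Heps.
destruct (is_derive_remainder H theta c 1 Hd ltac:(lra)) as [d [Hdel Hr]].
assert (Hc := Rabs_pos c).
assert (Hd2 : 0 < eps / (Rabs c + 1)) by (apply Rdiv_lt_0_compat; lra).
destruct (window_that theta M (Rmin d (eps / (Rabs c + 1)))) as [N HN].
{ apply Rmin_pos; trivial. }
exists N. intros n k Hn Hk Hz. destruct (HN n k Hn Hk Hz) as [H1 [H2 H3]].
assert (H4 := Rmin_l d (eps / (Rabs c + 1))). assert (H5 := Rmin_r d (eps / (Rabs c + 1))).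
specialize (Hr (that n k) ltac:(lra)). rewrite H0, Rminus_0_r in Hr.
assert (H6 : Rabs (that n k - theta) < eps / (Rabs c + 1)) by lra.
apply Rlt_div_r in H6; [|lra].
replace (H (that n k)) with (H (that n k) - c * (that n k - theta) + c * (that n k - theta)) by ring.
eapply Rle_trans; [apply Rabs_triang|]. rewrite Rabs_mult. lra.
Qed.

(** * Local limit theorem *)

(** The relative entropy of Bernoulli(t) with respect to Bernoulli(theta), which is the exponential
    rate of the binomial mass at k = n t. *)
Definition kl (theta t : R) : R :=
  t * (ln t - ln theta) + (1 - t) * (ln (1 - t) - ln (1 - theta)).

(** The second-order expansion is obtained from a first-order one: the derivative G of [kl] is
    linearised at theta, where it vanishes, and the mean value theorem integrates the error. The
    intermediate point is no farther from theta than t is. *)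
Lemma kl_quadratic theta eps : 0 < theta < 1 -> 0 < eps ->
  exists delta, 0 < delta /\ forall t, Rabs (t - theta) < delta ->
    Rabs (kl theta t - (t - theta) ^ 2 / (2 * (theta * (1 - theta)))) <= eps * (t - theta) ^ 2.
Proof.
intros Ht Heps. set (v := theta * (1 - theta)).
assert (Hv : 0 < v) by (apply Rmult_lt_0_compat; lra).
set (G := fun t => ln t - ln theta - ln (1 - t) + ln (1 - theta)).
destruct (is_derive_remainder G theta (/ v) eps) as [d [Hd HG]]; trivial.
{ unfold G. auto_derive; [lra|]. unfold v. field. lra. }
exists (Rmin d (Rmin theta (1 - theta))). split; [repeat apply Rmin_pos; lra|].
intros t H.
assert (H1 := Rmin_l d (Rmin theta (1 - theta))).
assert (H2 := Rmin_r d (Rmin theta (1 - theta))).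
assert (H3 := Rmin_l theta (1 - theta)). assert (H4 := Rmin_r theta (1 - theta)).
assert (Hc : forall c, Rmin theta t <= c <= Rmax theta t -> Rabs (c - theta) <= Rabs (t - theta)).
{ intros c. unfold Rmin, Rmax. destruct Rle_dec; intros Hc.
  - rewrite !Rabs_right; lra.
  - rewrite !Rabs_left1; lra. }
assert (Hd' : forall c, Rmin theta t <= c <= Rmax theta t ->
  is_derive (fun t => kl theta t - (t - theta) ^ 2 / (2 * v)) c (G c - / v * (c - theta))).
{ intros c Hcc. specialize (Hc c Hcc).
  assert (Hc2 : Rabs (c - theta) < Rmin theta (1 - theta)) by lra.
  apply Rabs_lt_between in Hc2.
  unfold kl, G. auto_derive; [lra|]. unfold Rminus. field. lra. }
destruct (MVT_gen (fun t => kl theta t - (t - theta) ^ 2 / (2 * v)) theta t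
            (fun c => G c - / v * (c - theta))) as [c [Hc1 Hc2]].
- intros c Hcc. apply Hd'; lra.
- intros c Hcc. apply derivable_continuous_pt. exists (G c - / v * (c - theta)).
  apply is_derive_Reals, Hd', Hcc.
- specialize (Hc c Hc1). specialize (HG c ltac:(lra)).
  replace (G theta) with 0 in HG by (unfold G; ring).
  replace (kl theta theta) with 0 in Hc2 by (unfold kl; ring).
  rewrite Rminus_diag in Hc2.
  replace (kl theta t - (t - theta) ^ 2 / (2 * v)) with ((G c - / v * (c - theta)) * (t - theta)).
  2:{ rewrite <- Hc2. field. lra. }
  rewrite Rabs_mult, <- (pow2_abs (t - theta)). rewrite Rminus_0_r in HG.
  assert (0 <= Rabs (t - theta)) by apply Rabs_pos.
  apply Rle_trans with (eps * Rabs (t - theta) * Rabs (t - theta)); [|right; ring].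
  apply Rmult_le_compat_r; trivial. nra.
Qed.

Lemma window_null_kl theta : 0 < theta < 1 ->
  window_null theta (fun n k => INR n * kl theta (that n k) -
     zscore theta n k ^ 2 / (2 * (theta * (1 - theta)))).
Proof.
intros Ht M eps Heps.
assert (Hv : 0 < theta * (1 - theta)) by (apply Rmult_lt_0_compat; lra).
assert (HM := pow2_ge_0 M).
destruct (kl_quadratic theta (eps / (M ^ 2 + 1)) Ht) as [d [Hd Hk]].
{ apply Rdiv_lt_0_compat; lra. }
destruct (window_that theta M d Hd) as [N HN]. exists N. intros n k Hn Hkn Hz.
destruct (HN n k Hn Hkn Hz) as [H1 [H2 H3]]. specialize (Hk _ H2).
assert (Es : sqrt (INR n) ^ 2 = INR n) by (simpl; rewrite Rmult_1_r; apply sqrt_sqrt; lra).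
assert (E : INR n * (that n k - theta) ^ 2 = zscore theta n k ^ 2).
{ rewrite H3, Rpow_mult_distr, Es. reflexivity. }
replace (INR n * kl theta (that n k) - zscore theta n k ^ 2 / (2 * (theta * (1 - theta)))) with
  (INR n * (kl theta (that n k) - (that n k - theta) ^ 2 / (2 * (theta * (1 - theta))))).
2:{ rewrite <- E. field. lra. }
rewrite Rabs_mult, (Rabs_right (INR n)) by lra.
apply Rle_trans with (eps / (M ^ 2 + 1) * zscore theta n k ^ 2).
- rewrite <- E.
  apply Rle_trans with (INR n * (eps / (M ^ 2 + 1) * (that n k - theta) ^ 2)); [|right; ring].
  apply Rmult_le_compat_l; lra.
- apply Rle_trans with (eps / (M ^ 2 + 1) * (M ^ 2 + 1)); [|right; field; lra].
  apply Rmult_le_compat_l; [apply Rlt_le, Rdiv_lt_0_compat; lra|].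
  assert (zscore theta n k ^ 2 <= M ^ 2); [|lra]. apply pow_maj_Rabs; trivial.
Qed.

(** The logarithm of the ratio of [C n k] to its Stirling approximation t^(-k) (1 - t)^(-(n - k)) /
    sqrt(2 pi n t (1 - t)), with t = k / n. *)
Definition stirling_corr (n k : nat) : R :=
  ln (C n k) + INR k * ln (that n k) + INR (n - k) * ln (1 - that n k) +
  (ln (2 * PI) + ln (INR n) + ln (that n k) + ln (1 - that n k)) / 2.

(** The correction is a signed sum of the three remainders for n, k and n - k, each centred at ln(2
    pi) / 2; all main terms cancel. *)
Lemma stirling_corr_le n k : (0 < k < n)%nat ->
  Rabs (stirling_corr n k) <= / 4 * (/ INR n + / INR k + / INR (n - k)).
Proof.
intros Hk.
assert (S1 := stirling n ltac:(lia)). assert (S2 := stirling k ltac:(lia)).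
assert (S3 := stirling (n - k) ltac:(lia)).
rewrite !Rinv_mult in *.
assert (P1 : 0 < INR n) by (apply lt_0_INR; lia).
assert (P2 : 0 < INR k) by (apply lt_0_INR; lia).
assert (P3 : 0 < INR (n - k)) by (apply lt_0_INR; lia).
assert (En : INR (n - k) = INR n - INR k) by (apply minus_INR; lia).
assert (E1 : 1 - that n k = INR (n - k) / INR n) by (unfold that; rewrite En; field; lra).
assert (E2 : ln (C n k) = ln (INR (fact n)) - ln (INR (fact k)) - ln (INR (fact (n - k)))).
{ unfold C. assert (F1 := INR_fact_lt_0 n). assert (F2 := INR_fact_lt_0 k).
  assert (F3 := INR_fact_lt_0 (n - k)).
  rewrite ln_div, ln_mult; try lra. apply Rmult_lt_0_compat; trivial. }
replace (stirling_corr n k) with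
  ((stirling_rem n - ln (2 * PI) / 2) - (stirling_rem k - ln (2 * PI) / 2) -
   (stirling_rem (n - k) - ln (2 * PI) / 2)).
2:{ unfold stirling_corr, stirling_rem. rewrite E1, E2. unfold that.
    rewrite !ln_div by trivial. rewrite En. field. }
apply Rabs_le. split; lra.
Qed.

(** On a window both k and n - k are of order n. This makes 1/k and 1/(n - k) of order 1/n and keeps
    the arguments of all logarithms positive. *)
Lemma window_interior theta M : 0 < theta < 1 -> exists N, forall n k,
  (N <= n)%nat -> (k <= n)%nat -> Rabs (zscore theta n k) <= M ->
  (0 < k < n)%nat /\ INR n * (theta / 2) <= INR k /\ INR n * ((1 - theta) / 2) <= INR (n - k).
Proof.
intros Ht. destruct (window_that theta M (Rmin theta (1 - theta) / 2)) as [N HN].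
{ assert (0 < Rmin theta (1 - theta)) by (apply Rmin_pos; lra). lra. }
exists N. intros n k Hn Hkn Hz. destruct (HN n k Hn Hkn Hz) as [H1 [H2 _]].
assert (H3 := Rmin_l theta (1 - theta)). assert (H4 := Rmin_r theta (1 - theta)).
apply Rabs_lt_between in H2. rewrite minus_INR by trivial.
assert (Ek : INR k = INR n * that n k) by (unfold that; field; lra).
assert (B1 : INR n * (theta / 2) <= INR k).
{ rewrite Ek. apply Rmult_le_compat_l; lra. }
assert (B2 : INR n * ((1 - theta) / 2) <= INR n - INR k).
{ rewrite Ek. replace (INR n - INR n * that n k) with (INR n * (1 - that n k)) by ring.
  apply Rmult_le_compat_l; lra. }
split; [|split; trivial].
assert (0 < INR n * (theta / 2)) by (apply Rmult_lt_0_compat; lra).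
assert (0 < INR n * ((1 - theta) / 2)) by (apply Rmult_lt_0_compat; lra).
split; apply INR_lt; simpl; lra.
Qed.

Lemma window_null_stirling theta : 0 < theta < 1 ->
  window_null theta (fun n k => sqrt (INR n) * stirling_corr n k).
Proof.
intros Ht. set (K := / 4 * (1 + 2 / theta + 2 / (1 - theta))).
apply window_null_le with (fun n _ => K / sqrt (INR n)); [|apply window_null_inv_sqrt].
intros M. destruct (window_interior theta M Ht) as [N HN]. exists N.
intros n k Hn Hkn Hz. destruct (HN n k Hn Hkn Hz) as [H1 [H2 H3]].
assert (P1 : 0 < INR n) by (apply lt_0_INR; lia).
assert (Hs : 0 < sqrt (INR n)) by (apply sqrt_lt_R0; trivial).
assert (Es : sqrt (INR n) * sqrt (INR n) = INR n) by (apply sqrt_sqrt; lra).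
assert (S := stirling_corr_le n k H1).
assert (B1 : / INR k <= 2 / theta * / INR n).
{ replace (2 / theta * / INR n) with (/ (INR n * (theta / 2))) by (field; lra).
  apply Rinv_le_contravar; trivial. apply Rmult_lt_0_compat; lra. }
assert (B2 : / INR (n - k) <= 2 / (1 - theta) * / INR n).
{ replace (2 / (1 - theta) * / INR n) with (/ (INR n * ((1 - theta) / 2))) by (field; lra).
  apply Rinv_le_contravar; trivial. apply Rmult_lt_0_compat; lra. }
rewrite Rabs_mult, (Rabs_right (sqrt _)) by lra.
eapply Rle_trans; [|apply Rle_abs].
apply Rle_trans with (sqrt (INR n) * (K * / INR n)).
- apply Rmult_le_compat_l; [lra|]. unfold K. lra.
- right. rewrite <- Es at 2. field. lra.
Qed.

Lemma window_null_of_sqrt theta e :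
  window_null theta (fun n k => sqrt (INR n) * e n k) -> window_null theta e.
Proof.
apply window_null_le. intros M. exists 1%nat. intros n k Hn _ _.
apply (le_INR 1) in Hn. assert (Hs : 1 <= sqrt (INR n)) by (rewrite <- sqrt_1; apply sqrt_le_1_alt, Hn).
rewrite Rabs_mult, (Rabs_right (sqrt _)) by lra. assert (H := Rabs_pos (e n k)). nra.
Qed.

Definition llt_err (theta : R) (n k : nat) : R :=
  ln (binom_pmf n theta k) -
  ln (/ sqrt (INR n) * normal_density (theta * (1 - theta)) (zscore theta n k)).

Lemma ln_sqrt x : 0 < x -> ln (sqrt x) = ln x / 2.
Proof.
intros Hx. assert (H := sqrt_lt_R0 x Hx).
rewrite <- (sqrt_sqrt x) at 2 by lra. rewrite ln_mult by trivial. field.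
Qed.

(** The log mass is exactly [stirling_corr] - n [kl] - ln(2 pi n t (1 - t)) / 2. Replacing n [kl] by
    z^2 / (2 v) and t (1 - t) by v turns it into the log density; each replacement costs o(1). *)
Lemma local_limit theta : 0 < theta < 1 -> window_null theta (llt_err theta).
Proof.
intros Ht. set (v := theta * (1 - theta)).
assert (Hv : 0 < v) by (apply Rmult_lt_0_compat; lra).
assert (HP := PI_RGT_0).
apply window_null_le with (fun n k => stirling_corr n k +
  ((- 1) * (INR n * kl theta (that n k) - zscore theta n k ^ 2 / (2 * v)) +
   (- / 2) * (ln (that n k) + ln (1 - that n k) - ln v))).
- intros M. destruct (window_interior theta M Ht) as [N HN]. exists N.
  intros n k Hn Hkn Hz. destruct (HN n k Hn Hkn Hz) as [H1 [H2 H3]].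
  assert (P1 : 0 < INR n) by (apply lt_0_INR; lia).
  assert (Hs : 0 < sqrt (INR n)) by (apply sqrt_lt_R0; trivial).
  right. f_equal. unfold llt_err, binom_pmf, normal_density. fold v.
  assert (T1 : 0 < theta ^ k) by (apply pow_lt; lra).
  assert (T2 : 0 < (1 - theta) ^ (n - k)) by (apply pow_lt; lra).
  assert (T3 := C_pos n k).
  assert (T4 : 0 < 2 * PI * v) by (apply Rmult_lt_0_compat; lra).
  assert (T5 := sqrt_lt_R0 _ T4).
  rewrite !ln_mult, !Rcomplements.ln_pow, ln_Rinv, ln_sqrt; try lra;
    try (apply Rinv_0_lt_compat; lra); try (apply Rmult_lt_0_compat; lra);
    try (apply Rdiv_lt_0_compat; [apply exp_pos|lra]).
  rewrite ln_div, ln_exp, ln_sqrt; try lra; try apply exp_pos.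
  rewrite (ln_mult (2 * PI)); try lra.
  unfold stirling_corr, kl.
  replace (INR (n - k)) with (INR n * (1 - that n k)).
  2:{ unfold that. rewrite minus_INR by lia. field. lra. }
  replace (INR k) with (INR n * that n k) by (unfold that; field; lra).
  field. lra.
- apply window_null_plus; [apply window_null_of_sqrt, window_null_stirling, Ht|].
  apply window_null_plus; apply window_null_scal; [apply window_null_kl, Ht|].
  apply window_null_continuous with (H := fun t => ln t + ln (1 - t) - ln v)
    (c := / theta - / (1 - theta)).
  + auto_derive; [lra|]. field. lra.
  + unfold v. rewrite ln_mult; lra.
Qed.

(** * Central limit theorem and linearisation *)

Lemma exp_sub1_le e eps : Rabs e <= eps -> eps <= 1 / 2 -> Rabs (exp e - 1) <= 2 * eps.
Proof.
intros He Heps. apply Rabs_le_between in He.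
assert (H1 := exp_ineq1_le e). assert (H2 := exp_ineq1_le (- e)).
apply Rabs_le. split; [lra|].
rewrite exp_Ropp in H2. assert (Hp := exp_pos e).
apply (Rmult_le_compat_r (exp e)) in H2; [|lra]. rewrite Rinv_l in H2 by lra. nra.
Qed.

Lemma clt theta a b : 0 < theta < 1 -> a < b ->
  Un_cv (fun n => binom_exp n theta (fun k => ind_Icc a b (zscore theta n k)))
        (RInt (normal_density (theta * (1 - theta))) a b).
Proof.
intros Ht Hab eta Heta. set (v := theta * (1 - theta)).
assert (Hv : 0 < v) by (apply Rmult_lt_0_compat; lra).
set (I := RInt (normal_density v) a b).
assert (HI := Rabs_pos I).
(* The bound 1/2 is the range of [exp_sub1_le]. The local limit theorem has a multiplicative error,
   which costs at most 2 eps s for the Riemann sum s <= |I| + 1, hence at most eta / 2. *)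
set (eps := Rmin (1 / 2) (eta / (4 * (Rabs I + 1)))).
assert (Heps : 0 < eps) by (apply Rmin_pos; [lra|apply Rdiv_lt_0_compat; lra]).
assert (He1 : eps <= 1 / 2) by apply Rmin_l.
assert (He2 : eps * (4 * (Rabs I + 1)) <= eta).
{ apply Rle_div_r; [lra|]. apply Rmin_r. }
destruct (lattice_normal theta v a b Ht Hv Hab (Rmin 1 (eta / 2))) as [N1 H1].
{ apply Rmin_pos; lra. }
destruct (local_limit theta Ht (Rabs a + Rabs b) eps Heps) as [N2 H2].
exists (S (N1 + N2)). intros n Hn. specialize (H1 n ltac:(lia)).
unfold Rdist in *. fold I in H1.
set (s := sum_f_R0 _ n) in H1.
assert (Hs : Rabs (s - I) < 1 /\ Rabs (s - I) < eta / 2).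
{ assert (h1 := Rmin_l 1 (eta / 2)). assert (h2 := Rmin_r 1 (eta / 2)). lra. }
destruct Hs as [Hs1 Hs2].
assert (Hn1 : 0 < INR n) by (apply lt_0_INR; lia).
assert (Hsq : 0 < / sqrt (INR n)) by (apply Rinv_0_lt_compat, sqrt_lt_R0; trivial).
assert (Hterm : forall k, (k <= n)%nat ->
  Rabs (ind_Icc a b (zscore theta n k) * binom_pmf n theta k -
        ind_Icc a b (zscore theta n k) * (/ sqrt (INR n) * normal_density v (zscore theta n k))) <=
  (2 * eps) * (ind_Icc a b (zscore theta n k) * (/ sqrt (INR n) * normal_density v (zscore theta n k)))).
{ intros k Hk.
  assert (Hd : 0 < / sqrt (INR n) * normal_density v (zscore theta n k)).
  { apply Rmult_lt_0_compat; [trivial|apply normal_density_pos; trivial]. }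
  assert (Hp := binom_pmf_pos n theta k Ht).
  unfold ind_Icc. destruct Rle_dec as [Ha|Ha]; [destruct Rle_dec as [Hb|Hb]|];
    try (rewrite !Rmult_0_l, Rminus_diag, Rabs_R0; lra).
  rewrite !Rmult_1_l.
  assert (Hz : Rabs (zscore theta n k) <= Rabs a + Rabs b).
  { assert (h1 := Rle_abs b). assert (h2 := Rle_abs (- a)). rewrite Rabs_Ropp in h2.
    assert (h3 := Rabs_pos a). assert (h4 := Rabs_pos b). apply Rabs_le. lra. }
  specialize (H2 n k ltac:(lia) Hk Hz). apply exp_sub1_le in H2; trivial.
  unfold llt_err in H2. fold v in H2.
  set (q := / sqrt (INR n) * normal_density v (zscore theta n k)) in *.
  unfold Rminus at 2 in H2. rewrite exp_plus, exp_Ropp, !exp_ln in H2 by trivial.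
  replace (binom_pmf n theta k - q) with ((binom_pmf n theta k * / q - 1) * q) by (field; lra).
  rewrite Rabs_mult, (Rabs_right q) by lra. apply Rmult_le_compat_r; lra. }
assert (Hdiff : Rabs (binom_exp n theta (fun k => ind_Icc a b (zscore theta n k)) - s) <= 2 * eps * s).
{ unfold binom_exp, s. rewrite <- minus_sum.
  eapply Rle_trans; [apply Rsum_abs|]. rewrite scal_sum.
  apply sum_Rle. intros k Hk. rewrite (Rmult_comm _ (2 * eps)). apply Hterm, Hk. }
assert (Hs3 : s <= Rabs I + 1).
{ apply Rabs_lt_between in Hs1. assert (h := Rle_abs I). lra. }
replace (binom_exp n theta (fun k => ind_Icc a b (zscore theta n k)) - I) with
  ((binom_exp n theta (fun k => ind_Icc a b (zscore theta n k)) - s) + (s - I)) by ring.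
eapply Rle_lt_trans; [apply Rabs_triang|].
assert (2 * eps * s <= 2 * eps * (Rabs I + 1)) by (apply Rmult_le_compat_l; lra).
lra.
Qed.

Lemma normal_density_scale v c y : 0 < v -> c <> 0 ->
  normal_density (c ^ 2 * v) (c * y) = normal_density v y / Rabs c.
Proof.
intros Hv Hc. unfold normal_density. assert (HP := PI_RGT_0).
assert (Hs : 0 < sqrt (2 * PI * v)) by (apply sqrt_lt_R0, Rmult_lt_0_compat; lra).
assert (Ha := Rabs_pos_lt c Hc).
replace (- (c * y) ^ 2 / (2 * (c ^ 2 * v))) with (- y ^ 2 / (2 * v)) by (field; lra).
replace (2 * PI * (c ^ 2 * v)) with (Rabs c ^ 2 * (2 * PI * v)) by (rewrite pow2_abs; ring).
rewrite sqrt_mult, sqrt_pow2; [field; lra|lra|apply pow2_ge_0|].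
apply Rlt_le, Rmult_lt_0_compat; lra.
Qed.

(** The substitution contributes c and the density 1 / |c|. For c < 0 the resulting sign is
    compensated by the reversed order of a / c and b / c. *)
Lemma RInt_normal_scale v c a b : 0 < v -> c <> 0 ->
  RInt (normal_density (c ^ 2 * v)) a b = c / Rabs c * RInt (normal_density v) (a / c) (b / c).
Proof.
intros Hv Hc. assert (Ha := Rabs_pos_lt c Hc).
assert (Hv' : 0 < c ^ 2 * v) by (apply Rmult_lt_0_compat; [apply pow2_gt_0|]; trivial).
assert (H := RInt_comp_lin (V := R_CompleteNormedModule) (normal_density (c ^ 2 * v)) c 0 (a / c) (b / c)).
replace (c * (a / c) + 0) with a in H by (field; trivial).
replace (c * (b / c) + 0) with b in H by (field; trivial).
rewrite <- H by (apply ex_RInt_normal; trivial).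
rewrite <- (RInt_scal (V := R_CompleteNormedModule) (normal_density v))
  by (apply ex_RInt_normal; trivial).
apply RInt_ext. intros y _.
change (c * normal_density (c ^ 2 * v) (c * y + 0) = c / Rabs c * normal_density v y).
rewrite Rplus_0_r, normal_density_scale by trivial. field. lra.
Qed.

Lemma clt_scaled theta c a b : 0 < theta < 1 -> c <> 0 -> a < b ->
  Un_cv (fun n => binom_exp n theta (fun k => ind_Icc a b (c * zscore theta n k)))
        (RInt (normal_density (c ^ 2 * (theta * (1 - theta)))) a b).
Proof.
intros Ht Hc Hab.
assert (Hv : 0 < theta * (1 - theta)) by (apply Rmult_lt_0_compat; lra).
rewrite RInt_normal_scale by trivial.
destruct (Rtotal_order c 0) as [Hlt|[->|Hgt]]; [|lra|].
- rewrite (Rabs_left c) by trivial.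
  assert (E : c / - c * RInt (normal_density (theta * (1 - theta))) (a / c) (b / c) =
              RInt (normal_density (theta * (1 - theta))) (b / c) (a / c)).
  { rewrite <- (opp_RInt_swap (V := R_CompleteNormedModule) _ (b / c) (a / c))
      by (apply ex_RInt_normal; trivial).
    unfold opp; simpl. field. lra. }
  rewrite E. eapply Un_cv_ext; [|apply (clt theta (b / c) (a / c) Ht)].
  + intros n. apply binom_exp_ext. intros k. set (z := zscore theta n k).
    assert (Ea : c * (a / c) = a) by (field; lra). assert (Eb : c * (b / c) = b) by (field; lra).
    unfold ind_Icc. repeat destruct Rle_dec; trivial; exfalso; nra.
  + apply (Rmult_lt_reg_l (- c)); [lra|].
    replace (- c * (b / c)) with (- b) by (field; lra). replace (- c * (a / c)) with (- a) by (field; lra). lra.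
- rewrite (Rabs_right c) by lra.
  replace (c / c) with 1 by (field; lra). rewrite Rmult_1_l.
  eapply Un_cv_ext; [|apply (clt theta (a / c) (b / c) Ht)].
  + intros n. apply binom_exp_ext. intros k. set (z := zscore theta n k).
    assert (Ea : c * (a / c) = a) by (field; lra). assert (Eb : c * (b / c) = b) by (field; lra).
    unfold ind_Icc. repeat destruct Rle_dec; trivial; exfalso; nra.
  + apply (Rmult_lt_reg_l c); [lra|].
    replace (c * (b / c)) with b by (field; lra). replace (c * (a / c)) with a by (field; lra). lra.
Qed.

Lemma RInt_normal_bounds v a b : 0 < v -> a <= b ->
  0 <= RInt (normal_density v) a b <= / sqrt (2 * PI * v) * (b - a).
Proof.
intros Hv Hab. rewrite <- RInt_normal_sub by trivial. split.
- assert (H := F_incr (normal_density v) (fun y => RInt (normal_density v) 0 y)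
    (fun x => Rlt_le _ _ (normal_density_pos v x Hv)) (fun x => RInt_normal_derive v x Hv) a b Hab).
  cbv beta in H. lra.
- exact (F_lip (normal_density v) (fun y => RInt (normal_density v) 0 y) _
    (fun x => normal_density_le v x Hv) (fun x => RInt_normal_derive v x Hv) a b Hab).
Qed.

Lemma RInt_normal_Chasles v a b c : 0 < v ->
  RInt (normal_density v) a c = RInt (normal_density v) a b + RInt (normal_density v) b c.
Proof.
intros Hv. assert (H1 := RInt_normal_sub v a b Hv). assert (H2 := RInt_normal_sub v b c Hv).
assert (H3 := RInt_normal_sub v a c Hv). lra.
Qed.

Lemma zscore_second_moment theta n : (1 <= n)%nat ->
  binom_exp n theta (fun k => zscore theta n k ^ 2) = theta * (1 - theta).
Proof.
intros Hn. assert (Hn' : 0 < INR n) by (apply lt_0_INR; lia).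
assert (Hs : 0 < sqrt (INR n)) by (apply sqrt_lt_R0; trivial).
assert (Es : sqrt (INR n) * sqrt (INR n) = INR n) by (apply sqrt_sqrt; lra).
rewrite (binom_exp_ext n theta _ (fun k => / INR n * (INR k - INR n * theta) ^ 2)).
- rewrite binom_exp_scal, binom_variance. field. lra.
- intros k. unfold zscore. replace (/ INR n) with (/ (sqrt (INR n) * sqrt (INR n))) by (rewrite Es; trivial).
  field. lra.
Qed.

Lemma cdf_of_binom_exp g theta n x :
  cdf_of g theta n x = binom_exp n theta (fun k => if Rle_dec (g n k) x then 1 else 0).
Proof. apply sum_eq. intros k _. destruct Rle_dec; ring. Qed.

(** A Slutsky argument at the level of distribution functions: up to the event |c z| > m, the event
    g <= x lies between c z <= x - delta and c z <= x + delta. *)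
Lemma conv_dist_normal_of_window g theta c : 0 < theta < 1 -> c <> 0 ->
  window_null theta (fun n k => g n k - c * zscore theta n k) ->
  conv_dist_normal g theta (c ^ 2 * (theta * (1 - theta))).
Proof.
intros Ht Hc Hg x.
assert (Hv : 0 < theta * (1 - theta)) by (apply Rmult_lt_0_compat; lra).
set (s2 := c ^ 2 * (theta * (1 - theta))).
assert (Hs2 : 0 < s2) by (apply Rmult_lt_0_compat; [apply pow2_gt_0|]; trivial).
set (I := fun m : nat => RInt (normal_density s2) (- INR m) x).
assert (Hgrow : Un_growing I).
{ intros m. unfold I. rewrite (RInt_normal_Chasles s2 (- INR (S m)) (- INR m)) by trivial.
  rewrite S_INR. destruct (RInt_normal_bounds s2 (- (INR m + 1)) (- INR m)); lra. }
assert (Hub : has_ub I).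
(* The truncated Gaussian integrals are bounded by 1 because the central limit theorem makes them
   limits of binomial probabilities. The index is enlarged first, so that the interval of
   integration is nondegenerate. *)
{ exists 1. intros y [m ->].
  destruct (nfloor_ex (Rmax 0 (- x))) as [m0 [_ Hm0]]; [apply Rmax_l|].
  assert (Hm0' := Rmax_r 0 (- x)).
  apply Rle_trans with (I (m + S m0)%nat).
  { apply Rge_le, growing_prop; trivial. lia. }
  assert (Hlt : - INR (m + S m0) < x).
  { rewrite plus_INR, S_INR. assert (h := pos_INR m). lra. }
  assert (Hcv := clt_scaled theta c _ _ Ht Hc Hlt). fold s2 in Hcv. fold (I (m + S m0)%nat) in Hcv.
  apply is_lim_seq_Reals in Hcv.
  apply (is_lim_seq_le _ (fun _ => 1) _ 1) with (2 := Hcv); [|apply is_lim_seq_const].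
  intros n. rewrite <- (binom_exp_const n theta 1). apply binom_exp_le; trivial.
  intros k _. apply ind_Icc_bounds. }
destruct (growing_cv I Hgrow Hub) as [L HL].
exists L, I. split; [|split; trivial].
{ intros m. exists (ex_RInt_Reals_0 _ _ _ (ex_RInt_normal s2 (- INR m) x Hs2)).
  symmetry. apply RInt_Reals. }
(* At most four errors of size eps occur: truncating the integral at - m, the Chebyshev bound for |c
   z| > m, the shift of x by delta, and the central limit theorem. *)
intros eta Heta. set (eps := eta / 5). assert (Heps : 0 < eps) by (unfold eps; lra).
destruct (HL eps Heps) as [m1 Hm1].
destruct (nfloor_ex (Rabs x + 1)) as [m2 [_ Hm2]]; [assert (h := Rabs_pos x); lra|].
destruct (eventually_sqrt_INR_ge (s2 / eps)) as [m3 Hm3].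
set (m := (m1 + (m2 + 1) + m3)%nat). specialize (Hm1 m ltac:(lia)).
assert (Hmx : Rabs x + 1 < INR m).
{ unfold m. rewrite !plus_INR. simpl (INR 1). assert (h1 := pos_INR m1). assert (h3 := pos_INR m3). lra. }
assert (Hmx1 := Rle_abs x). assert (Hmx2 := Rle_abs (- x)). rewrite Rabs_Ropp in Hmx2.
assert (Hm0 : 1 < INR m) by (assert (h := Rabs_pos x); lra).
assert (Hms : s2 / INR m ^ 2 <= eps).
{ destruct (Hm3 m ltac:(lia)) as [h1 h2]. apply Rle_div_l in h2; trivial.
  apply Rle_div_l; [apply pow_lt; lra|].
  assert (h3 : sqrt (INR m) <= INR m).
  { rewrite <- (sqrt_square (INR m)) at 2 by lra. apply sqrt_le_1_alt. nra. }
  assert (h4 : sqrt (INR m) <= INR m ^ 2) by nra.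
  nra. }
set (D := / sqrt (2 * PI * s2)).
assert (HD : 0 < D).
{ assert (HP := PI_RGT_0). apply Rinv_0_lt_compat, sqrt_lt_R0, Rmult_lt_0_compat; lra. }
set (delta := Rmin (1 / 2) (eps / D)).
assert (Hdel : 0 < delta) by (apply Rmin_pos; [lra|apply Rdiv_lt_0_compat; trivial]).
assert (Hdel1 : delta <= 1 / 2) by apply Rmin_l.
assert (Hdel2 : D * delta <= eps).
{ rewrite Rmult_comm. apply Rle_div_r; [trivial|apply Rmin_r]. }
(* The window |z| <= m / |c| is the one on which |c z| <= m. *)
destruct (Hg (INR m / Rabs c) delta Hdel) as [N1 H1].
destruct (clt_scaled theta c (- INR m) (x + delta) Ht Hc ltac:(lra) eps Heps) as [N2 H2].
destruct (clt_scaled theta c (- INR m) (x - delta) Ht Hc ltac:(lra) eps Heps) as [N3 H3].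
exists (N1 + N2 + N3)%nat. intros n' Hn'.
assert (exists n, n = S n') as [n En] by (eexists; reflexivity). rewrite <- En.
specialize (H2 n ltac:(lia)). specialize (H3 n ltac:(lia)).
fold s2 in H2, H3. unfold Rdist in *.
rewrite (RInt_normal_Chasles s2 _ x) in H2 by trivial.
assert (E3 := RInt_normal_Chasles s2 (- INR m) (x - delta) x Hs2).
fold (I m) in H2, E3.
destruct (RInt_normal_bounds s2 x (x + delta) Hs2 ltac:(lra)) as [B1 B2].
destruct (RInt_normal_bounds s2 (x - delta) x Hs2 ltac:(lra)) as [B3 B4].
fold D in B2, B4.
replace (D * (x + delta - x)) with (D * delta) in B2 by ring.
replace (D * (x - (x - delta))) with (D * delta) in B4 by ring.
assert (Hg' : forall k, (k <= n)%nat -> Rabs (c * zscore theta n k) <= INR m ->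
  Rabs (g n k - c * zscore theta n k) <= delta).
{ intros k Hk Hz. apply H1; [lia|trivial|].
  rewrite Rabs_mult in Hz. apply Rle_div_r; [apply Rabs_pos_lt; trivial|]. lra. }
assert (U : cdf_of g theta n x <=
  binom_exp n theta (fun k => ind_Icc (- INR m) (x + delta) (c * zscore theta n k)) + s2 / INR m ^ 2).
{ rewrite cdf_of_binom_exp.
  replace (s2 / INR m ^ 2) with (binom_exp n theta (fun k => c ^ 2 / INR m ^ 2 * zscore theta n k ^ 2)).
  2:{ rewrite binom_exp_scal, zscore_second_moment by lia. unfold s2. field. lra. }
  rewrite <- binom_exp_plus. apply binom_exp_le; trivial. intros k Hk.
  specialize (Hg' k Hk). set (z := c * zscore theta n k) in *.
  replace (c ^ 2 / INR m ^ 2 * zscore theta n k ^ 2) with (z ^ 2 / INR m ^ 2) by (unfold z; field; lra).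
  assert (Hi := ind_Icc_bounds (- INR m) (x + delta) z).
  assert (Hz2 : 0 <= z ^ 2 / INR m ^ 2).
  { apply Rdiv_le_0_compat; [apply pow2_ge_0|apply pow_lt; lra]. }
  destruct Rle_dec as [Hle|]; [|lra].
  destruct (Rle_lt_dec (Rabs z) (INR m)) as [Hz|Hz].
  - specialize (Hg' Hz). apply Rabs_le_between in Hg'. apply Rabs_le_between in Hz.
    unfold ind_Icc in *. destruct Rle_dec; [destruct Rle_dec|]; lra.
  (* Chebyshev's inequality pointwise: outside the window the quadratic term alone is at least 1. *)
  - assert (1 <= z ^ 2 / INR m ^ 2); [|lra].
    apply Rle_div_r; [apply pow_lt; lra|]. rewrite <- (pow2_abs z), Rmult_1_l.
    apply pow_incr; lra. }
assert (Lo : binom_exp n theta (fun k => ind_Icc (- INR m) (x - delta) (c * zscore theta n k)) <=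
  cdf_of g theta n x).
{ rewrite cdf_of_binom_exp. apply binom_exp_le; trivial. intros k Hk.
  specialize (Hg' k Hk). set (z := c * zscore theta n k) in *.
  unfold ind_Icc. destruct Rle_dec; [destruct Rle_dec|]; destruct Rle_dec as [Hle|Hle]; try lra.
  exfalso. apply Hle. assert (Hz : Rabs z <= INR m) by (apply Rabs_le; lra).
  specialize (Hg' Hz). apply Rabs_le_between in Hg'. lra. }
apply Rabs_lt_between in Hm1. apply Rabs_lt_between in H2. apply Rabs_lt_between in H3.
apply Rabs_lt_between. unfold eps in *. lra.
Qed.

(** * Binomial tails and the main theorem *)

Lemma tail_sum_split (f : nat -> R) n k : (k <= n)%nat ->
  sum_f_R0 (fun j => if Compare_dec.le_dec k j then f j else 0) n =
  f k + sum_f_R0 (fun j => if Compare_dec.le_dec (S k) j then f j else 0) n.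
Proof.
induction n as [|n IH]; intros Hk.
- assert (k = 0%nat) as -> by lia. simpl. repeat destruct Compare_dec.le_dec; try lia; ring.
- rewrite !tech5. destruct (Compare_dec.le_lt_dec k n) as [H|H].
  + rewrite IH by trivial. repeat destruct Compare_dec.le_dec; try lia; ring.
  + assert (k = S n) as -> by lia.
    rewrite (sum_eq _ (fun j => if Compare_dec.le_dec (S (S n)) j then f j else 0)).
    * repeat destruct Compare_dec.le_dec; try lia; ring.
    * intros j Hj. repeat destruct Compare_dec.le_dec; trivial; lia.
Qed.

Lemma P_X_step n k phi : (k <= n)%nat ->
  P_X n k phi = binom_pmf n phi k + P_X n (S k) phi.
Proof. intros Hk. exact (tail_sum_split (binom_pmf n phi) n k Hk). Qed.

Lemma P_X_nonneg n k phi : 0 < phi < 1 -> 0 <= P_X n k phi.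
Proof.
intros Hp. apply cond_pos_sum. intros j. destruct Compare_dec.le_dec; [|lra].
apply Rlt_le. exact (binom_pmf_pos n phi j Hp).
Qed.

Lemma P_X_last n phi : P_X n n phi = binom_pmf n phi n.
Proof.
rewrite P_X_step by lia. replace (P_X n (S n) phi) with 0; [ring|].
symmetry. unfold P_X. rewrite (sum_eq _ (fun _ => 0)).
- rewrite sum_cte. ring.
- intros j Hj. destruct Compare_dec.le_dec; [lia|trivial].
Qed.

Lemma binom_pmf_ratio n k phi : (k < n)%nat ->
  INR (S k) * (1 - phi) * binom_pmf n phi (S k) = (INR n - INR k) * phi * binom_pmf n phi k.
Proof.
intros Hk. unfold binom_pmf, C.
assert (E : (n - k)%nat = S (n - S k)) by lia.
assert (En : INR n - INR k = INR (S (n - S k))) by (rewrite <- E, minus_INR; [trivial|lia]).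
rewrite En, E.
change (fact (S k)) with (S k * fact k)%nat.
change (fact (S (n - S k))) with (S (n - S k) * fact (n - S k))%nat.
rewrite !mult_INR.
assert (F1 := INR_fact_lt_0 k). assert (F2 := INR_fact_lt_0 (n - S k)).
assert (0 < INR (S k)) by (apply lt_0_INR; lia).
assert (0 < INR (S (n - S k))) by (apply lt_0_INR; lia).
rewrite <- !tech_pow_Rmult. field. lra.
Qed.

(** Downward induction from k = n, where equality holds. By [binom_pmf_ratio] the right-hand side at
    k + 1 is (n - k) phi times the mass at k, and k (1 - phi) - (n - k) phi = k - n phi is exactly
    the coefficient of the new term; raising k - n phi to k + 1 - n phi in front of the remaining
    tail gives the inequality. *)
Lemma P_X_upper n phi i : 0 < phi < 1 -> forall k, (k + i)%nat = n -> INR n * phi <= INR k ->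
  (INR k - INR n * phi) * P_X n k phi <= INR k * (1 - phi) * binom_pmf n phi k.
Proof.
intros Hp. induction i as [|i IH]; intros k Hk Hx.
- assert (k = n) as -> by lia. rewrite P_X_last. right. ring.
- assert (H := IH (S k) ltac:(lia)). rewrite binom_pmf_ratio in H by lia.
  rewrite P_X_step by lia. assert (H0 := P_X_nonneg n (S k) phi Hp).
  rewrite S_INR in H. specialize (H ltac:(lra)). nra.
Qed.

(* The error of the induction step is the tail beyond k, which [P_X_upper] bounds by
   [A * binom_pmf n phi k]. *)
Lemma P_X_lower n phi A i : 0 < phi < 1 -> 0 <= A -> forall k, (k + i)%nat = n ->
  INR n * phi <= INR k -> INR n <= A * (INR k - INR n * phi) ->
  INR k * (1 - phi) * binom_pmf n phi k <= (INR k - INR n * phi + A) * P_X n k phi.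
Proof.
intros Hp HA. induction i as [|i IH]; intros k Hk Hx Hn.
- assert (k = n) as -> by lia. rewrite P_X_last.
  assert (H := binom_pmf_pos n phi n Hp). nra.
- assert (H := IH (S k) ltac:(lia)). rewrite binom_pmf_ratio in H by lia.
  assert (U := P_X_upper n phi i Hp (S k) ltac:(lia)). rewrite binom_pmf_ratio in U by lia.
  rewrite P_X_step by lia. assert (H0 := P_X_nonneg n (S k) phi Hp).
  rewrite S_INR in H, U. specialize (H ltac:(lra) ltac:(lra)). specialize (U ltac:(lra)).
  assert (Hb := binom_pmf_pos n phi k Hp). assert (Hk0 := pos_INR k).
  assert (Hkn : INR k <= INR n) by (apply le_INR; lia).
  set (x := INR k - INR n * phi) in *. set (b := binom_pmf n phi k) in *.
  set (P := P_X n (S k) phi) in *.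
  replace (INR k + 1 - INR n * phi) with (x + 1) in * by (unfold x; ring).
  assert (HP : P <= A * b).
  { apply (Rmult_le_reg_l (x + 1)); [unfold x; lra|].
    eapply Rle_trans; [exact U|].
    apply Rle_trans with (INR n * b).
    - apply Rmult_le_compat_r; [lra|]. nra.
    - apply Rle_trans with (A * x * b); [apply Rmult_le_compat_r; lra|].
      assert (0 <= A * b) by (apply Rmult_le_pos; lra). lra. }
  assert (E : INR k * (1 - phi) * b = x * b + (INR n - INR k) * phi * b) by (unfold x; ring).
  rewrite E. lra.
Qed.

Definition tail_err (phi : R) (n k : nat) : R :=
  ln (P_X n k phi) + ln (INR k - INR n * phi) - ln (INR k * (1 - phi) * binom_pmf n phi k).

(** A measures the distance of k from n phi in units of n; for fixed A the bound is O(1/n), which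
    survives multiplication by [sqrt n]. *)
Lemma tail_err_le phi A n k : 0 < phi < 1 -> 0 <= A -> (0 < k <= n)%nat ->
  INR n * phi < INR k -> INR n <= A * (INR k - INR n * phi) ->
  Rabs (tail_err phi n k) <= A / (INR k - INR n * phi).
Proof.
intros Hp HA Hk Hx Hn. unfold tail_err.
assert (U := P_X_upper n phi (n - k) Hp k ltac:(lia) ltac:(lra)).
assert (L := P_X_lower n phi A (n - k) Hp HA k ltac:(lia) ltac:(lra) Hn).
assert (Hk0 : 0 < INR k) by (apply lt_0_INR; lia).
assert (HB : 0 < INR k * (1 - phi) * binom_pmf n phi k).
{ apply Rmult_lt_0_compat; [|apply binom_pmf_pos; trivial]. apply Rmult_lt_0_compat; lra. }
set (B := INR k * (1 - phi) * binom_pmf n phi k) in *.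
set (x := INR k - INR n * phi) in *. assert (Hx0 : 0 < x) by (unfold x; lra).
set (P := P_X n k phi) in *.
assert (HP : 0 < P).
{ destruct (P_X_nonneg n k phi Hp) as [H|H]; [exact H|]. fold P in H. rewrite <- H in L. lra. }
assert (H1 : ln (x * P) <= ln B) by (apply ln_le; [apply Rmult_lt_0_compat|]; trivial).
rewrite ln_mult in H1 by trivial.
assert (HAx : 0 <= A / x) by (apply Rdiv_le_0_compat; trivial).
assert (H2 : ln B <= ln (x * (1 + A / x) * P)).
{ apply ln_le; trivial. replace (x * (1 + A / x)) with (x + A) by (field; lra). trivial. }
rewrite !ln_mult in H2; try lra; try (apply Rmult_lt_0_compat; lra).
assert (H3 : ln (1 + A / x) <= A / x).
{ rewrite <- (ln_exp (A / x)) at 2. apply ln_le; [lra|apply exp_ineq1_le]. }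
apply Rabs_le. lra.
Qed.

(** * Logarithms of the bounds at interior counts *)

Lemma that_facts n k : (0 < k < n)%nat ->
  0 < that n k < 1 /\ INR k = INR n * that n k /\ INR (n - k) = INR n * (1 - that n k) /\ 0 < INR n.
Proof.
intros Hk. assert (P1 : 0 < INR n) by (apply lt_0_INR; lia).
assert (P2 : 0 < INR k) by (apply lt_0_INR; lia).
assert (P3 : INR k < INR n) by (apply lt_INR; lia).
assert (E : INR k = INR n * that n k) by (unfold that; field; lra).
repeat split; trivial.
- apply Rdiv_lt_0_compat; trivial.
- unfold that. apply Rlt_div_l; lra.
- rewrite minus_INR by lia. rewrite E. ring.
Qed.

Lemma P_CH_pos n k phi : 0 < phi < 1 -> (0 < k < n)%nat -> 0 < P_CH n k phi.
Proof.
intros Hp Hk. destruct (that_facts n k Hk) as [Ht _].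
unfold P_CH; cbv zeta. destruct Rle_dec; [|lra].
apply Rmult_lt_0_compat; apply pow_lt, Rdiv_lt_0_compat; lra.
Qed.

(** [P_CH] carries the same powers of phi and 1 - phi as the mass, so their ratio depends on n and k
    alone. *)
Lemma ln_pmf_P_CH n k phi : 0 < phi < 1 -> (0 < k < n)%nat -> phi <= that n k ->
  ln (binom_pmf n phi k) - ln (P_CH n k phi) =
  stirling_corr n k - (ln (2 * PI) + ln (INR n) + ln (that n k) + ln (1 - that n k)) / 2.
Proof.
intros Hp Hk Hle. destruct (that_facts n k Hk) as [Ht _].
unfold P_CH; cbv zeta. destruct Rle_dec; [|lra].
assert (T1 : 0 < phi / that n k) by (apply Rdiv_lt_0_compat; lra).
assert (T2 : 0 < (1 - phi) / (1 - that n k)) by (apply Rdiv_lt_0_compat; lra).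
assert (T3 : 0 < phi ^ k) by (apply pow_lt; lra).
assert (T4 : 0 < (1 - phi) ^ (n - k)) by (apply pow_lt; lra).
assert (T5 := C_pos n k). assert (HPI := PI_RGT_0).
unfold binom_pmf, stirling_corr.
rewrite !ln_mult, !Rcomplements.ln_pow, !ln_div; try lra;
  try (apply pow_lt; lra); try (apply Rmult_lt_0_compat; lra).
Qed.

(** This selects the branch t >= phi of [P_CH] and [P_PBR] and keeps ln(t - phi) away from its
    singularity. *)
Lemma window_gap phi theta M : phi < theta -> exists N, forall n k,
  (N <= n)%nat -> (k <= n)%nat -> Rabs (zscore theta n k) <= M ->
  (theta - phi) / 2 <= that n k - phi.
Proof.
intros H. destruct (window_that theta M ((theta - phi) / 2) ltac:(lra)) as [N HN].
exists N. intros n k Hn Hk Hz. destruct (HN n k Hn Hk Hz) as [_ [H2 _]].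
apply Rabs_lt_between in H2. lra.
Qed.

(** [P_PBR] carries the factor n + 1, while the normalisation and the Stirling prefactor together
    supply n. *)
Lemma window_null_ln_succ theta :
  window_null theta (fun n _ => sqrt (INR n) * (ln (INR (n + 1)) - ln (INR n))).
Proof.
apply window_null_le with (fun n _ => 1 / sqrt (INR n)); [|apply window_null_inv_sqrt].
intros M. exists 1%nat. intros n k Hn _ _.
assert (P1 : 0 < INR n) by (apply lt_0_INR; lia).
assert (Hs : 0 < sqrt (INR n)) by (apply sqrt_lt_R0; trivial).
assert (Es : sqrt (INR n) * sqrt (INR n) = INR n) by (apply sqrt_sqrt; lra).
assert (Hi : 0 < / INR n) by (apply Rinv_0_lt_compat; trivial).
assert (E : ln (INR (n + 1)) - ln (INR n) = ln (1 + / INR n)).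
{ rewrite plus_INR. simpl (INR 1). rewrite <- ln_div by lra. f_equal. field. lra. }
assert (H1 : 0 <= ln (1 + / INR n)) by (rewrite <- ln_1; apply ln_le; lra).
assert (H2 : ln (1 + / INR n) <= / INR n).
{ rewrite <- (ln_exp (/ INR n)) at 2. apply ln_le; [lra|apply exp_ineq1_le]. }
rewrite E, !Rabs_right.
- apply Rle_trans with (sqrt (INR n) * / INR n); [apply Rmult_le_compat_l; lra|].
  right. replace (/ INR n) with (/ (sqrt (INR n) * sqrt (INR n))) by (rewrite Es; trivial). field. lra.
- apply Rle_ge, Rdiv_le_0_compat; lra.
- apply Rle_ge, Rmult_le_pos; lra.
Qed.

Lemma window_null_tail phi theta : 0 < phi -> phi < theta -> theta < 1 ->
  window_null theta (fun n k => sqrt (INR n) * tail_err phi n k).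
Proof.
(* On the window k - n phi >= n (theta - phi) / 2, which is the hypothesis of [tail_err_le] for this
   A. *)
intros H1 H2 H3. set (A := 2 / (theta - phi)).
assert (HA : 0 < A) by (apply Rdiv_lt_0_compat; lra).
apply window_null_le with (fun n _ => A ^ 2 / sqrt (INR n)); [|apply window_null_inv_sqrt].
intros M. destruct (window_interior theta M ltac:(lra)) as [N1 HN1].
destruct (window_gap phi theta M H2) as [N2 HN2].
exists (N1 + N2)%nat. intros n k Hn Hk Hz.
destruct (HN1 n k ltac:(lia) Hk Hz) as [Hk' _]. specialize (HN2 n k ltac:(lia) Hk Hz).
destruct (that_facts n k Hk') as [_ [Ek [_ P1]]].
assert (Hs : 0 < sqrt (INR n)) by (apply sqrt_lt_R0; trivial).
assert (Es : sqrt (INR n) * sqrt (INR n) = INR n) by (apply sqrt_sqrt; lra).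
assert (Hx : INR n * ((theta - phi) / 2) <= INR k - INR n * phi).
{ replace (INR k - INR n * phi) with (INR n * (that n k - phi)) by (rewrite Ek; ring).
  apply Rmult_le_compat_l; lra. }
assert (Hx0 : 0 < INR n * ((theta - phi) / 2)) by (apply Rmult_lt_0_compat; lra).
assert (Hnx : INR n <= A * (INR k - INR n * phi)).
{ replace (INR n) with (A * (INR n * ((theta - phi) / 2))) at 1 by (unfold A; field; lra).
  apply Rmult_le_compat_l; lra. }
assert (T := tail_err_le phi A n k ltac:(lra) ltac:(lra) ltac:(lia) ltac:(lra) Hnx).
rewrite Rabs_mult, (Rabs_right (sqrt _)) by lra.
eapply Rle_trans; [|apply Rle_abs].
apply Rle_trans with (sqrt (INR n) * (A ^ 2 / INR n)).
- apply Rmult_le_compat_l; [lra|]. eapply Rle_trans; [exact T|].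
  apply Rle_trans with (A / (INR n * ((theta - phi) / 2))).
  + apply Rmult_le_compat_l; [lra|]. apply Rinv_le_contravar; trivial.
  + right. unfold A. field. lra.
- right. rewrite <- Es at 2. field. lra.
Qed.

Theorem mainTheorem10 (phi theta : R) :
  0 < phi -> phi < theta -> theta < 1 ->
  (theta <> 1/2 ->
    conv_dist_normal
      (fun n k => - sqrt (INR n) *
         ln (sqrt (2 * PI * theta * (1 - theta)) * P_PBR n k phi /
             (sqrt (INR n) * P_CH n k phi)))
      theta
      ((1 - 2 * theta) ^ 2 / (4 * theta * (1 - theta)))) /\
  (phi <> theta * (2 * theta - 1) ->
    conv_dist_normal
      (fun n k => - sqrt (INR n) *
         ln ((theta - phi) / (1 - phi) * sqrt (2 * PI * (1 - theta) / theta) *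
             (sqrt (INR n) * P_X n k phi / P_CH n k phi)))
      theta
      ((theta * (1 - 2 * theta) + phi) ^ 2 /
         (4 * (theta - phi) ^ 2 * theta * (1 - theta)))).
Proof.
intros H1 H2 H3. assert (HPI := PI_RGT_0).
assert (Hp : 0 < phi < 1) by lra. assert (Ht : 0 < theta < 1) by lra.
split; intros Hne.
(* This is H'(theta) for H(t) = ln(t (1 - t) / (theta (1 - theta))) / 2, the logarithm of the
   Stirling prefactor relative to its value at theta. *)
- set (c := (1 - 2 * theta) / (2 * theta * (1 - theta))).
  replace ((1 - 2 * theta) ^ 2 / (4 * theta * (1 - theta))) with (c ^ 2 * (theta * (1 - theta)))
    by (unfold c; field; lra).
  apply conv_dist_normal_of_window; trivial.
  { unfold c. apply Rmult_integral_contrapositive_currified; [lra|].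
    apply Rinv_neq_0_compat. assert (0 < theta * (1 - theta)) by (apply Rmult_lt_0_compat; lra). lra. }
  set (H := fun t => (ln t + ln (1 - t) - ln theta - ln (1 - theta)) / 2).
  apply window_null_le with (fun n k => (sqrt (INR n) * H (that n k) - c * zscore theta n k) +
    ((- 1) * (sqrt (INR n) * stirling_corr n k) +
     (- 1) * (sqrt (INR n) * (ln (INR (n + 1)) - ln (INR n))))).
  + intros M. destruct (window_interior theta M Ht) as [N1 HN1].
    destruct (window_gap phi theta M H2) as [N2 HN2].
    exists (N1 + N2)%nat. intros n k Hn Hk Hz.
    destruct (HN1 n k ltac:(lia) Hk Hz) as [Hk' _]. specialize (HN2 n k ltac:(lia) Hk Hz).
    destruct (that_facts n k Hk') as [Htk [_ [_ P1]]].
    assert (L := ln_pmf_P_CH n k phi Hp Hk' ltac:(lra)).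
    assert (HCH := P_CH_pos n k phi Hp Hk'). assert (Hb := binom_pmf_pos n phi k Hp).
    assert (E : P_PBR n k phi = INR (n + 1) * binom_pmf n phi k).
    { unfold P_PBR, binom_pmf; cbv zeta. destruct Rle_dec; [ring|lra]. }
    assert (P2 : 0 < INR (n + 1)) by (apply lt_0_INR; lia).
    assert (Hs : 0 < sqrt (INR n)) by (apply sqrt_lt_R0; trivial).
    assert (T1 : 0 < 2 * PI * theta) by (apply Rmult_lt_0_compat; lra).
    assert (T2 : 0 < 2 * PI * theta * (1 - theta)) by (apply Rmult_lt_0_compat; lra).
    assert (T3 := sqrt_lt_R0 _ T2).
    assert (T4 : 0 < INR (n + 1) * binom_pmf n phi k) by (apply Rmult_lt_0_compat; lra).
    (* On the window the comparison is an identity, since all arguments of [ln] are positive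
       there. *)
    right. f_equal. rewrite E.
    rewrite ln_div, (ln_mult (sqrt (INR n))), ln_mult, (ln_mult (INR (n + 1))), !ln_sqrt; try lra;
      try (apply Rmult_lt_0_compat; lra).
    rewrite (ln_mult (2 * PI * theta)), (ln_mult (2 * PI)) by lra.
    replace (ln (binom_pmf n phi k)) with (ln (P_CH n k phi) + (stirling_corr n k -
      (ln (2 * PI) + ln (INR n) + ln (that n k) + ln (1 - that n k)) / 2)) by lra.
    unfold H. field.
  + apply window_null_plus; [|apply window_null_plus; apply window_null_scal].
    * apply window_null_derive; unfold H; [|field].
      auto_derive; [lra|]. unfold c. field. lra.
    * apply window_null_stirling, Ht.
    * apply window_null_ln_succ.
(* This is 1 / (theta - phi) - 1 / (2 theta (1 - theta)), the derivative at theta of the H below.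
   That H combines the Stirling prefactor with the tail factor t / (t - phi), which changes the sign
   of (ln t) / 2. *)
- set (c := (theta * (1 - 2 * theta) + phi) / (2 * (theta - phi) * theta * (1 - theta))).
  replace ((theta * (1 - 2 * theta) + phi) ^ 2 / (4 * (theta - phi) ^ 2 * theta * (1 - theta)))
    with (c ^ 2 * (theta * (1 - theta))) by (unfold c; field; lra).
  apply conv_dist_normal_of_window; trivial.
  { unfold c. apply Rmult_integral_contrapositive_currified; [lra|].
    apply Rinv_neq_0_compat, Rgt_not_eq. repeat apply Rmult_lt_0_compat; lra. }
  set (H := fun t => (ln (t - phi) - ln (theta - phi)) - (ln t - ln theta) / 2 +
                     (ln (1 - t) - ln (1 - theta)) / 2).
  apply window_null_le with (fun n k => (sqrt (INR n) * H (that n k) - c * zscore theta n k) +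
    ((- 1) * (sqrt (INR n) * stirling_corr n k) + (- 1) * (sqrt (INR n) * tail_err phi n k))).
  + intros M. destruct (window_interior theta M Ht) as [N1 HN1].
    destruct (window_gap phi theta M H2) as [N2 HN2].
    exists (N1 + N2)%nat. intros n k Hn Hk Hz.
    destruct (HN1 n k ltac:(lia) Hk Hz) as [Hk' _]. specialize (HN2 n k ltac:(lia) Hk Hz).
    destruct (that_facts n k Hk') as [Htk [Ek [_ P1]]].
    assert (L := ln_pmf_P_CH n k phi Hp Hk' ltac:(lra)).
    assert (HCH := P_CH_pos n k phi Hp Hk'). assert (Hb := binom_pmf_pos n phi k Hp).
    assert (HX : 0 < P_X n k phi).
    { rewrite P_X_step by lia. assert (h := P_X_nonneg n (S k) phi Hp). lra. }
    assert (Hs : 0 < sqrt (INR n)) by (apply sqrt_lt_R0; trivial).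
    assert (T1 : 0 < 2 * PI * (1 - theta)) by (apply Rmult_lt_0_compat; lra).
    assert (T2 : 0 < 2 * PI * (1 - theta) / theta) by (apply Rdiv_lt_0_compat; lra).
    assert (T3 := sqrt_lt_R0 _ T2).
    assert (T4 : 0 < (theta - phi) / (1 - phi)) by (apply Rdiv_lt_0_compat; lra).
    assert (T5 : 0 < sqrt (INR n) * P_X n k phi) by (apply Rmult_lt_0_compat; lra).
    assert (T6 : 0 < sqrt (INR n) * P_X n k phi / P_CH n k phi) by (apply Rdiv_lt_0_compat; lra).
    assert (T7 : 0 < (theta - phi) / (1 - phi) * sqrt (2 * PI * (1 - theta) / theta))
      by (apply Rmult_lt_0_compat; lra).
    right. f_equal.
    rewrite (ln_mult _ (_ / P_CH n k phi)), (ln_mult (_ / _)), (ln_div (theta - phi)), ln_sqrt,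
      (ln_div (_ * _) theta), (ln_mult (2 * PI)), (ln_div (_ * _) (P_CH _ _ _)),
      (ln_mult (sqrt _)), ln_sqrt by lra.
    unfold tail_err.
    replace (INR k - INR n * phi) with (INR n * (that n k - phi)) by (rewrite Ek; ring).
    rewrite (ln_mult (INR n) (that n k - phi)) by lra.
    replace (ln (INR k * (1 - phi) * binom_pmf n phi k)) with
      (ln (INR n) + ln (that n k) + ln (1 - phi) + ln (binom_pmf n phi k)).
    2:{ rewrite Ek at 1. 
        assert (T8 : 0 < INR n * that n k) by (apply Rmult_lt_0_compat; lra).
        assert (T9 : 0 < INR n * that n k * (1 - phi)) by (apply Rmult_lt_0_compat; lra).
        rewrite !ln_mult; lra. }
    replace (ln (binom_pmf n phi k)) with (ln (P_CH n k phi) + (stirling_corr n k -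
      (ln (2 * PI) + ln (INR n) + ln (that n k) + ln (1 - that n k)) / 2)) by lra.
    unfold H. field.
  + apply window_null_plus; [|apply window_null_plus; apply window_null_scal].
    * apply window_null_derive; unfold H; [|field].
      auto_derive; [lra|]. unfold c. field. lra.
    * apply window_null_stirling, Ht.
    * apply window_null_tail; trivial.
Qed.
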